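(* Let $(X,\mathcal{B},\mu)$ be a standard probability space, let $r\geq 2$ be an integer, and let $\mathfrak{P}_r$ be the collection of all finite measurable partitions of $X$ with at most $r$ atoms. For a subset $K$ of $\mathfrak{P}_r$, the following assertions are equivalent: (1) $K$ is precompact in the Rokhlin metric $\rho$ on $\mathfrak{P}_r$; (2) the maximal pattern entropy $h^*_\mu(K)$ of $K$ is zero; (3) the set $\{\mathbf{1}_A\colon A\in\alpha\in K\}$ is precompact in $L^2(\mu)$; (4) $K$ has bounded mean complexity (with respect to the Hamming distance).
   Context: A finite partition of $X$ is a finite collection of pairwise disjoint measurable sets (atoms) whose union is $X$ modulo $\mu$-null sets; two partitions are identified if each atom of either one is, mod $0$, a union of atoms of the other. For partitions $\alpha,\beta$, $\alpha\vee\beta=\{A\cap B\colon A\in\alpha,B\in\beta\}$. Entropy: $H_\mu(\alpha)=-\sum_{A\in\alpha}\mu(A)\log\mu(A)$ (with $0\log 0=0$). Conditional entropy: $H_\mu(\alpha|\beta)=\sum_{B\in\beta}\mu(B)\sum_{A\in\alpha}-\mu(A|B)\log\mu(A|B)$, where $\mu(A|B)=\mu(A\cap B)/\mu(B)$ if $\mu(B)>0$ and $0$ otherwise. The Rokhlin metric is $\rho(\alpha,\beta)=H_\mu(\alpha|\beta)+H_\mu(\beta|\alpha)$. Maximal pattern entropy: for $K\subset\mathfrak{P}_r$ and $n\in\mathbb{N}$, $P^*_{K,\mu}(n)=\sup_{\alpha_1,\dots,\alpha_n\in K}H_\mu(\bigvee_{i=1}^n\alpha_i)$ and $h^*_\mu(K)=\limsup_{n\to\infty}\frac1n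 P^*_{K,\mu}(n)$. Bounded mean complexity: for a finite nonempty $E\subset\mathfrak{P}_r$ and $x,y\in X$, the normalized Hamming distance is $H_E(x,y)=\frac{1}{|E|}\,|\{\alpha\in E\colon x,y \text{ lie in different atoms of }\alpha\}|$. Put $B_{H_E}(x,\varepsilon)=\{y\colon H_E(x,y)<\varepsilon\}$ and $\mathcal{C}(E,\varepsilon)=\min\{|D|\colon D\subset X \text{ finite},\ \mu(\bigcup_{x\in D}B_{H_E}(x,\varepsilon))>1-\varepsilon\}$. A set $K\subset\mathfrak{P}_r$ has bounded mean complexity if for every $\varepsilon>0$ there is $C\in\mathbb{N}$ with $\mathcal{C}(E,\varepsilon)\leq C$ for every finite nonempty subset $E$ of $K$. *)

(* Defs.v *)
From HB Require Import structures.
From mathcomp Require Import all_boot all_order all_algebra.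
From mathcomp Require Import all_classical all_reals all_analysis.
Set Implicit Arguments. Unset Strict Implicit. Unset Printing Implicit Defensive.
Import Order.TTheory GRing.Theory Num.Theory numFieldNormedType.Exports.
Local Open Scope classical_set_scope.
Local Open Scope ring_scope.

Definition polish_metric (T : Type) (R : realType) (dist : T -> T -> R) : Prop :=
  [/\ (forall x y, dist x y = 0 <-> x = y),
      (forall x y, dist x y = dist y x),
      (forall x y z, dist x z <= dist x y + dist y z),
      (exists D : set T, countable D /\
         forall x (e : R), 0 < e -> exists2 y, D y & dist x y < e) &
      (forall u : nat -> T,
         (forall e : R, 0 < e -> exists N, forall m n, (N <= m)%N -> (N <= n)%N ->
            dist (u m) (u n) < e) ->
         exists l, forall e : R, 0 < e -> exists N, forall n, (N <= n)%N ->
            dist (u n) l < e)].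

Definition metric_open (T : Type) (R : realType) (dist : T -> T -> R) (U : set T) : Prop :=
  forall x, U x -> exists2 e : R, 0 < e & [set y | dist x y < e] `<=` U.

Definition standard_borel (d : measure_display) (T : measurableType d) (R : realType) : Prop :=
  exists dist : T -> T -> R, polish_metric dist /\
    (@measurable d T = <<s [set U | metric_open dist U] >>).

(* A partition with at most r atoms is represented by an r-indexed family of
   pairwise disjoint measurable sets (unused slots are empty) covering X up to
   a null set. *)
Definition is_partition (d : measure_display) (T : measurableType d) (R : realType)
  (mu : set T -> \bar R) (r : nat) (a : 'I_r -> set T) : Prop :=
  [/\ (forall i, measurable (a i)),
      (forall i j, i != j -> a i `&` a j = set0) &
      mu (~` \bigcup_i a i) = 0%E].

Definition partitions (d : measure_display) (T : measurableType d) (R : realType)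
  (mu : set T -> \bar R) (r : nat) : set ('I_r -> set T) :=
  [set a | is_partition mu a].

Definition null_eq (T : Type) (R : realType) (mu : set T -> \bar R) (A B : set T) : Prop :=
  mu ((A `\` B) `|` (B `\` A)) = 0%E.

Definition refines_mod0 (T : Type) (R : realType) (mu : set T -> \bar R) (r s : nat)
  (a : 'I_r -> set T) (b : 'I_s -> set T) : Prop :=
  forall i, exists S : set 'I_s, null_eq mu (a i) (\bigcup_(j in S) b j).

Definition same_partition (T : Type) (R : realType) (mu : set T -> \bar R) (r s : nat)
  (a : 'I_r -> set T) (b : 'I_s -> set T) : Prop :=
  refines_mod0 mu a b /\ refines_mod0 mu b a.

Definition mreal (T : Type) (R : realType) (mu : set T -> \bar R) (A : set T) : R :=
  fine (mu A).

Definition plogp (R : realType) (x : R) : R := if x == 0 then 0 else x * ln x.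

Definition entropy (T : Type) (R : realType) (mu : set T -> \bar R) (r : nat)
  (a : 'I_r -> set T) : R :=
  - \sum_(i < r) plogp (mreal mu (a i)).

Definition cprob (T : Type) (R : realType) (mu : set T -> \bar R) (A B : set T) : R :=
  if 0 < mreal mu B then mreal mu (A `&` B) / mreal mu B else 0.

Definition cond_entropy (T : Type) (R : realType) (mu : set T -> \bar R) (r s : nat)
  (a : 'I_r -> set T) (b : 'I_s -> set T) : R :=
  \sum_(j < s) mreal mu (b j) * \sum_(i < r) - plogp (cprob mu (a i) (b j)).

Definition rokhlin (T : Type) (R : realType) (mu : set T -> \bar R) (r : nat)
  (a b : 'I_r -> set T) : R :=
  cond_entropy mu a b + cond_entropy mu b a.

Definition join_entropy (T : Type) (R : realType) (mu : set T -> \bar R) (r n : nat)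
  (al : 'I_n -> 'I_r -> set T) : R :=
  - \sum_(f : {ffun 'I_n -> 'I_r}) plogp (mreal mu (\bigcap_i al i (f i))).

(* P*_{K,mu}(n) = sup over al_1..al_n in K of H(join); 0 is added to the set
   (a harmless convention: all entropies are >= 0) so that K = empty gives 0. *)
Definition pattern_entropy (T : Type) (R : realType) (mu : set T -> \bar R) (r : nat)
  (K : set ('I_r -> set T)) (n : nat) : \bar R :=
  ereal_sup ([set 0%E] `|`
    [set (join_entropy mu al)%:E | al in [set al : 'I_n -> 'I_r -> set T | forall i, K (al i)]]).

Definition max_pattern_entropy (T : Type) (R : realType) (mu : set T -> \bar R) (r : nat)
  (K : set ('I_r -> set T)) : \bar R :=
  limn_esup (fun n => ((n%:R : R)^-1)%:E * pattern_entropy mu K n)%E.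

Definition rokhlin_precompact (d : measure_display) (T : measurableType d) (R : realType)
  (mu : set T -> \bar R) (r : nat) (K : set ('I_r -> set T)) : Prop :=
  forall u : nat -> ('I_r -> set T), (forall n, K (u n)) ->
    exists phi : nat -> nat, (forall m n, (m < n)%N -> (phi m < phi n)%N) /\
      exists2 b, is_partition mu b &
        (fun n => rokhlin mu (u (phi n)) b) @ \oo --> (0 : R).

Definition L2dist2 (d : measure_display) (T : measurableType d) (R : realType)
  (mu : {measure set T -> \bar R}) (f g : T -> R) : \bar R :=
  (\int[mu]_x (((f x - g x) ^+ 2)%R)%:E)%E.

Definition L2_precompact (d : measure_display) (T : measurableType d) (R : realType)
  (mu : {measure set T -> \bar R}) (S : set (T -> R)) : Prop :=
  forall f : nat -> (T -> R), (forall n, S (f n)) ->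
    exists phi : nat -> nat, (forall m n, (m < n)%N -> (phi m < phi n)%N) /\
      exists g : T -> R, [/\ measurable_fun setT g,
        (\int[mu]_x ((g x ^+ 2)%R)%:E < +oo)%E &
        (fun n => L2dist2 mu (f (phi n)) g) @ \oo --> 0%E].

Definition atom_indicators (T : Type) (R : realType) (r : nat)
  (K : set ('I_r -> set T)) : set (T -> R) :=
  [set f | exists a, exists i, K a /\ f = \1_(a i)].

Definition sep_by (T : Type) (r : nat) (a : 'I_r -> set T) (x y : T) : Prop :=
  ~ (exists j, a j x /\ a j y).

(* normalized Hamming distance H_E for E = {e_0,...,e_(n-1)} (e injective) *)
Definition hamming (T : Type) (R : realType) (r n : nat) (e : 'I_n -> 'I_r -> set T)
  (x y : T) : R :=
  (n%:R)^-1 * (#|[set i : 'I_n | `[< sep_by (e i) x y >] ]|)%:R.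

Definition hball (T : Type) (R : realType) (r n : nat) (e : 'I_n -> 'I_r -> set T)
  (x : T) (eps : R) : set T :=
  [set y | hamming R e x y < eps].

Definition mean_complexity_le (d : measure_display) (T : measurableType d) (R : realType) (mu : set T -> \bar R) (r n : nat)
  (e : 'I_n -> 'I_r -> set T) (eps : R) (C : nat) : Prop :=
  exists D : seq T, (size D <= C)%N /\
    ((1 - eps)%:E < mu (\bigcup_(x in [set` D]) hball e x eps))%E.

Definition bounded_mean_complexity (d : measure_display) (T : measurableType d) (R : realType) (mu : set T -> \bar R)
  (r : nat) (K : set ('I_r -> set T)) : Prop :=
  forall eps : R, 0 < eps -> exists C : nat,
    forall (n : nat) (e : 'I_n -> 'I_r -> set T),
      (0 < n)%N -> injective e -> (forall i, K (e i)) ->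
      mean_complexity_le mu e eps C.

(* Main.v *)
(* Precompactness is compared with finite nets throughout.
   (1) => (2): conditional entropy obeys the triangle inequality, so K has a
   finite net b_1, ..., b_m with H(a | b_k) < e for every a in K and some k; hence
   H(a_1 v ... v a_n) <= m log r + n e.
   (2) => (3): if every finite join c of members of K had some a in K with
   H(a | c) >= e, the chain rule would give joins of entropy >= n e.  So one finite
   join c has H(a | c) < e for all a in K, and each atom of K is close to one of
   the finitely many unions of cells of c.
   (3) => (4): two points in the same cell of the partition generated by a finite
   net of the atoms are separated only by those a in E for which one of them lies
   in a small error set, and Markov's inequality bounds the set of points lying in
   many error sets.
   (4) => (1): a partition in E is approximated, on average, by giving each Hamming
   ball the label of its centre.  There are boundedly many ways to label the
   centres, so a large E contains two partitions that are close to each other. *)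
Require Import Defs.
From HB Require Import structures.
From mathcomp Require Import all_boot all_order all_algebra.
From mathcomp Require Import all_classical all_reals all_analysis.
From mathcomp Require Import measurable_realfun ring lra.
Import Order.TTheory GRing.Theory Num.Theory numFieldNormedType.Exports.
Local Open Scope classical_set_scope.
Local Open Scope ring_scope.
Set Implicit Arguments. Unset Strict Implicit. Unset Printing Implicit Defensive.

(** * Symmetric differences and sums over finite types *)

Definition symdiff (T : Type) (A B : set T) : set T := (A `\` B) `|` (B `\` A).

Lemma symdiffC (T : Type) (A B : set T) : symdiff A B = symdiff B A.
Proof. by rewrite /symdiff setUC. Qed.

Lemma symdiff_sub (T : Type) (A B C : set T) :
  symdiff A C `<=` symdiff A B `|` symdiff B C.
Proof.
move=> x; rewrite /symdiff /=.
by case: (pselect (B x)) => ?; case=> -[? ?]; tauto.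
Qed.

Lemma fsbig_fintype (V : Type) (idx : V) (op : Monoid.com_law idx)
    (I : finType) (f : I -> V) :
  \big[op/idx]_(i \in [set: I]) f i = \big[op/idx]_i f i.
Proof.
rewrite (fsbigE (index_enum I)) ?index_enum_uniq//.
  by apply: eq_bigl => i; rewrite in_setT.
by move=> i _; rewrite mem_index_enum.
Qed.

(** * Finite partitions modulo null sets, their joins and cells *)

Section FinitePartitions.
Context {d : measure_display} {T : measurableType d} {R : realType}.
Variable mu : probability T R.
Local Notation P := (mreal mu).

Lemma mrealE A : measurable A -> mu A = (P A)%:E.
Proof. by move=> mA; rewrite /mreal fineK// fin_num_measure. Qed.

Lemma mreal_ge0 A : 0 <= P A.
Proof. exact/fine_ge0/measure_ge0. Qed.

Lemma measure_eq0 A : measurable A -> P A <= 0 -> mu A = 0%E.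
Proof.
by move=> mA PA; rewrite mrealE//; congr _%:E; apply/eqP; rewrite eq_le PA mreal_ge0.
Qed.

Lemma le_mreal A B : measurable A -> measurable B -> A `<=` B -> P A <= P B.
Proof.
move=> mA mB AB; rewrite -lee_fin -!mrealE//.
by apply: le_measure => //; rewrite inE.
Qed.

Lemma mrealT : P setT = 1.
Proof. by rewrite /mreal probability_setT. Qed.

Lemma mreal_le1 A : measurable A -> P A <= 1.
Proof. by move=> mA; rewrite -mrealT; apply: le_mreal. Qed.

Lemma mreal0 : P set0 = 0.
Proof. by rewrite /mreal measure0. Qed.

Lemma mreal_setDI A B : measurable A -> measurable B ->
  P A = P (A `\` B) + P (A `&` B).
Proof.
move=> mA mB; apply: EFin_inj; rewrite EFinD -!mrealE//.
- exact: measureDI.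
- exact: measurableI.
- exact: measurableD.
Qed.

Lemma mreal_setU A B : measurable A -> measurable B ->
  P (A `|` B) <= P A + P B.
Proof.
move=> mA mB; have mU : measurable (A `|` B) by apply: measurableU.
rewrite (mreal_setDI mU mB); apply: lerD; apply: le_mreal => //.
- exact: measurableD.
- by move=> x [[]].
- exact: measurableI.
Qed.

Lemma measurable_symdiff (A B : set T) :
  measurable A -> measurable B -> measurable (symdiff A B).
Proof. by move=> mA mB; apply: measurableU; apply: measurableD. Qed.

Lemma mreal_symdiff_triangle (A B C : set T) :
  measurable A -> measurable B -> measurable C ->
  P (symdiff A C) <= P (symdiff A B) + P (symdiff B C).
Proof.
move=> mA mB mC; have mAB := measurable_symdiff mA mB; have mBC := measurable_symdiff mB mC.
apply: le_trans (mreal_setU mAB mBC).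
apply: le_mreal; [exact: measurable_symdiff| |exact: symdiff_sub].
by apply: measurableU; apply: measurable_symdiff.
Qed.

Lemma measurable_bigcup_fin (I : finType) (D : set I) (F : I -> set T) :
  (forall i, measurable (F i)) -> measurable (\bigcup_(i in D) F i).
Proof. by move=> mF; apply: fin_bigcup_measurable. Qed.

Lemma measurable_bigcap_fin (I : finType) (D : set I) (F : I -> set T) :
  (forall i, measurable (F i)) -> measurable (\bigcap_(i in D) F i).
Proof. by move=> mF; apply: fin_bigcap_measurable. Qed.

Lemma mreal_bigcup_disj (I : finType) (F : I -> set T) :
  (forall i, measurable (F i)) -> (forall i j, i != j -> F i `&` F j = set0) ->
  P (\bigcup_i F i) = \sum_i P (F i).
Proof.
move=> mF dF; apply: EFin_inj.
rewrite -sumEFin -mrealE; last exact: measurable_bigcup_fin.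
rewrite measure_fin_bigcup//; first last.
- by apply/trivIsetP => i j _ _; exact: dF.
- exact: finite_finset.
rewrite fsbig_fintype.
by apply: eq_bigr => i _; exact: mrealE.
Qed.

Lemma mreal_cover_le (I : finType) (A : set T) (F : I -> set T) :
  measurable A -> (forall i, measurable (F i)) -> A `<=` \bigcup_i F i ->
  P A <= \sum_i P (F i).
Proof.
move=> mA mF AF; rewrite -lee_fin -sumEFin -mrealE//.
have fT : finite_set [set: I] by apply: finite_finset.
have := content_sub_fsum mu fT (fun i _ => mF i) mA AF.
rewrite fsbig_fintype => /le_trans; apply.
by apply: lee_sum => i _; rewrite -mrealE.
Qed.

(** Stated for any finite index type so that joins, indexed by pairs or by functions, are again
    partitions. Over ['I_r] it is convertible with [is_partition]. *)
Definition fpart (I : finType) (B : I -> set T) : Prop :=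
  [/\ (forall i, measurable (B i)),
      (forall i j, i != j -> B i `&` B j = set0) &
      mu (~` \bigcup_i B i) = 0%E].

Lemma mreal_fpart (I : finType) (B : I -> set T) A :
  fpart B -> measurable A -> P A = \sum_i P (A `&` B i).
Proof.
move=> [mB dB B0] mA.
have mU : measurable (\bigcup_i B i) by apply: measurable_bigcup_fin.
rewrite (mreal_setDI mA mU) (_ : P (A `\` _) = 0) ?add0r; last first.
  apply/eqP; rewrite eq_le mreal_ge0 andbT.
  have -> : 0 = P (~` \bigcup_i B i) by rewrite /mreal B0.
  apply: le_mreal; [exact: measurableD|exact: measurableC|].
  by move=> x [].
rewrite setI_bigcupr mreal_bigcup_disj// => [i|i j ij].
  exact: measurableI.
by rewrite setIACA dB// setI0.
Qed.

Lemma fpart_sum1 (I : finType) (B : I -> set T) :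
  fpart B -> \sum_i P (B i) = 1.
Proof.
move=> fB; rewrite -mrealT (mreal_fpart fB)//.
by apply: eq_bigr => i _; rewrite setTI.
Qed.

Definition part_join (I J : finType) (A : I -> set T) (B : J -> set T) :
  I * J -> set T := fun p => A p.1 `&` B p.2.

(** Indexed as in [join_entropy], whose value is therefore the entropy of these cells by
    conversion. *)
Definition part_cells (N J : finType) (A : N -> J -> set T) :
  {ffun N -> J} -> set T := fun f => \bigcap_k A k (f k).

Lemma fpart_join (I J : finType) (A : I -> set T) (B : J -> set T) :
  fpart A -> fpart B -> fpart (part_join A B).
Proof.
move=> [mA dA A0] [mB dB B0]; split.
- by move=> [i j]; apply: measurableI.
- move=> [i j] [i' j']; rewrite xpair_eqE negb_and /part_join/= setIACA.
  by case/orP=> [/dA|/dB] ->; rewrite ?set0I ?setI0.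
- have mUA := measurable_bigcup_fin setT mA.
  have mUB := measurable_bigcup_fin setT mB.
  have mp p : measurable (part_join A B p) by apply: measurableI.
  have mU : measurable (~` \bigcup_p part_join A B p).
    exact/measurableC/measurable_bigcup_fin.
  apply: measure_eq0 => //.
  have <- : P (~` (\bigcup_i A i)) + P (~` (\bigcup_i B i)) = 0.
    by rewrite /mreal A0 B0 addr0.
  apply: le_trans (mreal_setU (measurableC mUA) (measurableC mUB)).
  apply: le_mreal => //; first by apply: measurableU; apply: measurableC.
  move=> x nx; apply: contrapT => /not_orP[/contrapT[i _ Ai] /contrapT[j _ Bj]].
  by apply: nx; exists (i, j).
Qed.

Lemma fpart_cells (N J : finType) (A : N -> J -> set T) :
  (forall k, fpart (A k)) -> fpart (part_cells A).
Proof.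
move=> fA; split.
- by move=> f; apply: measurable_bigcap_fin => k; case: (fA k).
- move=> f g /eqP fg; rewrite -subset0 => x [fx gx]; apply: fg; apply/ffunP => k.
  apply/eqP; apply: contrapT => /negP fgk; have [_ /(_ _ _ fgk) + _] := fA k.
  by rewrite -subset0; apply; split; [exact: fx|exact: gx].
- have mc k : measurable (~` \bigcup_j A k j).
    by apply/measurableC/measurable_bigcup_fin => j; case: (fA k).
  have mU : measurable (~` \bigcup_f part_cells A f).
    apply/measurableC/measurable_bigcup_fin => f.
    by apply: measurable_bigcap_fin => k; case: (fA k).
  apply: measure_eq0 => //.
  rewrite (le_trans (@mreal_cover_le _ _ (fun k => ~` \bigcup_j A k j) _ _ _))//.
    move=> x nx; apply: contrapT => nk; apply: nx.
    have /choice[f fP] : forall k, exists j, A k j x.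
      move=> k; apply: contrapT => kn; apply: nk; exists k => // -[j _ Aj].
      by apply: kn; exists j.
    by exists (finfun f) => // k _; rewrite ffunE.
  by rewrite big1// => k _; rewrite /mreal; case: (fA k) => _ _ ->.
Qed.

End FinitePartitions.

(** * Inequalities for the logarithm *)

Lemma plogpE (R : realType) (x : R) : plogp x = x * ln x.
Proof. by rewrite /plogp; case: eqP => // ->; rewrite mul0r. Qed.

Lemma ln_le_subr1 (R : realType) (x : R) : 0 < x -> ln x <= x - 1.
Proof.
move=> x0; rewrite -[in leLHS](subrKC 1 x); apply: le_ln1Dx; lra.
Qed.

(** The tangent bound [ln x <= x - 1] at [x = q / w], multiplied by [w]. It is the pointwise form of
    Gibbs' inequality. *)
Lemma mulr_ln_sub_le (R : realType) (w q : R) : 0 <= w -> 0 <= q ->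
  (0 < w -> 0 < q) -> w * ln q - w * ln w <= q - w.
Proof.
move=> w0 q0; rewrite le_eqVlt in w0.
case/orP: w0 => [/eqP <- _|w0 /(_ w0){}q0]; first by rewrite !mul0r !subr0.
have := ln_le_subr1 (divr_gt0 q0 w0).
rewrite lnM ?posrE ?invr_gt0// lnV ?posrE// -(ler_pM2l w0).
by rewrite !mulrBr mulr1 mulrCA divff ?gt_eqF// mulr1.
Qed.

Lemma ln_prod (R : realType) (I : finType) (F : I -> R) :
  (forall i, 0 < F i) -> ln (\prod_i F i) = \sum_i ln (F i).
Proof.
move=> F0.
have : 0 < \prod_i F i /\ ln (\prod_i F i) = \sum_i ln (F i).
  elim/big_rec2: _ => [|i y1 y2 _ [y0 <-]]; first by rewrite ln1.
  by rewrite mulr_gt0// lnM ?posrE.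
by case.
Qed.

(** * Entropy and conditional entropy of finite partitions *)

Section Entropy.
Context {d : measure_display} {T : measurableType d} {R : realType}.
Variable mu : probability T R.
Local Notation P := (mreal mu).

Definition part_entropy (I : finType) (B : I -> set T) : R :=
  - \sum_i plogp (P (B i)).

(* MathComp-Analysis sets ln 0 = 0, so null cells contribute 0. *)
Definition part_cond_entropy (I J : finType) (A : I -> set T) (B : J -> set T) : R :=
  - \sum_p P (part_join A B p) * ln (cprob mu (A p.1) (B p.2)).

Lemma part_entropyE (I : finType) (B : I -> set T) :
  part_entropy B = - \sum_i P (B i) * ln (P (B i)).
Proof. by congr (- _); apply: eq_bigr => i _; rewrite plogpE. Qed.

(** Up to a null set, [A j] is the disjoint union of the [B w] with [X w = j]. Entropies of
    different partitions thereby become sums over one common refinement and can be compared term by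
    term. *)
Lemma fpart_refine_sum (I J : finType) (A : J -> set T) (B : I -> set T)
    (X : I -> J) (G : J -> R) :
  fpart mu A -> fpart mu B -> (forall w, B w `<=` A (X w)) ->
  \sum_j P (A j) * G j = \sum_w P (B w) * G (X w).
Proof.
move=> fA fB BA; have [mA dA _] := fA.
under eq_bigr => j _ do rewrite (mreal_fpart fB (mA j)) mulr_suml.
rewrite exchange_big/=; apply: eq_bigr => w _.
rewrite (bigD1 (X w))//= [X in _ + X]big1 ?addr0.
  by rewrite setIidr.
move=> j jX; suff -> : A j `&` B w = set0 by rewrite mreal0 mul0r.
rewrite -subset0 => x [Aj /BA AX]; rewrite -(dA _ _ jX); by split.
Qed.

(** The pointwise bounds are summed, and the cells have total mass 1. The mass of [q] may be smaller
    than 1 because [cprob] is 0 given a null cell, so conditional laws can lose mass. *)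
Lemma gibbs (I : finType) (B : I -> set T) (q : I -> R) :
  fpart mu B -> (forall w, 0 <= q w) -> (forall w, 0 < P (B w) -> 0 < q w) ->
  \sum_w q w <= 1 -> part_entropy B <= - \sum_w P (B w) * ln (q w).
Proof.
move=> fB q0 Bq q1; rewrite -subr_le0 opprK addrC -sumrB.
apply: (@le_trans _ _ (\sum_w (q w - P (B w)))).
  apply: ler_sum => w _; rewrite plogpE; apply: mulr_ln_sub_le => //.
    exact: mreal_ge0.
  exact: Bq.
by rewrite sumrB (fpart_sum1 fB) subr_le0.
Qed.

Lemma part_entropy_ge0 (I : finType) (B : I -> set T) :
  fpart mu B -> 0 <= part_entropy B.
Proof.
move=> [mB _ _]; rewrite oppr_ge0 sumr_le0// => i _; rewrite plogpE.
by apply: mulr_ge0_le0; [exact: mreal_ge0|exact/ln_le0/mreal_le1].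
Qed.

Lemma part_entropy_refine (I J : finType) (A : J -> set T) (B : I -> set T)
    (X : I -> J) :
  fpart mu A -> fpart mu B -> (forall w, B w `<=` A (X w)) ->
  part_entropy A <= part_entropy B.
Proof.
move=> fA fB BA; have [mA _ _] := fA; have [mB _ _] := fB; rewrite !part_entropyE lerN2.
rewrite (fpart_refine_sum (fun j => ln (P (A j))) fA fB BA).
apply: ler_sum => w _.
have := mreal_ge0 mu (B w); rewrite le_eqVlt => /orP[/eqP <-|B0].
  by rewrite !mul0r.
have BAP : P (B w) <= P (A (X w)) by apply: le_mreal.
by rewrite ler_pM2l// ler_ln// posrE// (lt_le_trans B0).
Qed.

Lemma cprob_ge0 A B : 0 <= cprob mu A B.
Proof.
by rewrite /cprob; case: ifP => // B0; rewrite divr_ge0// mreal_ge0.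
Qed.

Lemma cprob_le1 A B : measurable A -> measurable B -> cprob mu A B <= 1.
Proof.
move=> mA mB; rewrite /cprob; case: ifP => // B0.
by rewrite ler_pdivrMr// mul1r le_mreal//; exact: measurableI.
Qed.

Lemma cprob_mul A B : measurable A -> measurable B ->
  P B * cprob mu A B = P (A `&` B).
Proof.
move=> mA mB; rewrite /cprob; case: ifPn => [B0|].
  by rewrite mulrCA divff ?mulr1// gt_eqF.
rewrite -leNgt mulr0 => B0; apply/esym/eqP; rewrite eq_le mreal_ge0 andbT.
by apply: le_trans B0; apply: le_mreal => //; exact: measurableI.
Qed.

Lemma cprob_gt0 A B : measurable A -> measurable B -> 0 < P (A `&` B) ->
  0 < cprob mu A B.
Proof.
move=> mA mB AB; rewrite lt_neqAle cprob_ge0 andbT eq_sym; apply/eqP => c0.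
by move: AB; rewrite -cprob_mul// c0 mulr0 ltxx.
Qed.

Lemma cprob_sum (I : finType) (A : I -> set T) B :
  fpart mu A -> measurable B -> \sum_i cprob mu (A i) B <= 1.
Proof.
move=> fA mB; rewrite /cprob; case: (ltrP 0 (P B)) => [B0|_]; last by rewrite big1.
rewrite -mulr_suml ler_pdivrMr// mul1r (mreal_fpart fA mB).
by apply: ler_sum => i _; rewrite setIC.
Qed.

Lemma part_cond_entropy_ge0 (I J : finType) (A : I -> set T) (B : J -> set T) :
  fpart mu A -> fpart mu B -> 0 <= part_cond_entropy A B.
Proof.
move=> [mA _ _] [mB _ _]; rewrite oppr_ge0 sumr_le0// => p _.
by apply: mulr_ge0_le0; [exact: mreal_ge0|exact/ln_le0/cprob_le1].
Qed.

(** Chain rule: on each cell of the join, [ln P(A B) = ln P(B) + ln P(A | B)], and null cells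
    contribute 0. *)
Lemma part_entropy_join (I J : finType) (A : I -> set T) (B : J -> set T) :
  fpart mu A -> fpart mu B ->
  part_entropy (part_join A B) = part_entropy B + part_cond_entropy A B.
Proof.
move=> fA fB; have [mA _ _] := fA; have [mB _ _] := fB.
rewrite /part_entropy /part_cond_entropy.
under [in RHS]eq_bigr do rewrite plogpE.
rewrite (@fpart_refine_sum _ _ B (part_join A B) snd)//; last 2 first.
- exact: fpart_join.
- by move=> p x [].
rewrite -opprD -big_split/=; congr (- _); apply: eq_bigr => p _.
rewrite plogpE -mulrDr.
have := mreal_ge0 mu (part_join A B p).
rewrite le_eqVlt => /orP[/eqP <-|AB0]; first by rewrite !mul0r.
have B0 : 0 < P (B p.2).
  apply: lt_le_trans AB0 _; apply: le_mreal => //; last by move=> x [].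
  exact: measurableI.
by rewrite -lnM ?posrE// ?cprob_mul//; exact: cprob_gt0.
Qed.

(** Adding the entropy of [C] turns the left side into the entropy of a join, and refining that join
    by [B] can only raise it. *)
Lemma part_cond_entropy_triangle (I J L : finType)
    (A : I -> set T) (B : J -> set T) (C : L -> set T) :
  fpart mu A -> fpart mu B -> fpart mu C ->
  part_cond_entropy A C <= part_cond_entropy A B + part_cond_entropy B C.
Proof.
move=> fA fB fC; have [mA _ _] := fA; have [mB _ _] := fB; have [mC _ _] := fC.
have fAB := fpart_join fA fB; have fBC := fpart_join fB fC.
have fABC := fpart_join fAB fC.
rewrite -(lerD2l (part_entropy C)) -part_entropy_join//.
apply: (@le_trans _ _ (part_entropy (part_join (part_join A B) C))).
  apply: (@part_entropy_refine _ _ _ _ (fun p => (p.1.1, p.2))) => //.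
    exact: fpart_join.
  by move=> p x [[]].
(* Gibbs' inequality against the law making A and C independent given B. *)
pose q (p : I * J * L) :=
  P (C p.2) * cprob mu (B p.1.2) (C p.2) * cprob mu (A p.1.1) (B p.1.2).
have pos (p : I * J * L) : 0 < P (part_join (part_join A B) C p) ->
    [/\ 0 < P (C p.2), 0 < cprob mu (B p.1.2) (C p.2) &
        0 < cprob mu (A p.1.1) (B p.1.2)].
  have [_ _ _] := fABC; have [mABC _ _] := fABC.
  move=> p0; split.
  - apply: lt_le_trans p0 _; apply: le_mreal => //; by move=> x [].
  - apply: cprob_gt0 => //; apply: lt_le_trans p0 _; apply: le_mreal => //.
      exact: measurableI.
    by move=> x [[]].
  - apply: cprob_gt0 => //; apply: lt_le_trans p0 _; apply: le_mreal => //.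
      exact: measurableI.
    by move=> x [[]].
apply: (@le_trans _ _ _ _ _ (@gibbs _ _ q fABC _ _ _)).
- by move=> p; rewrite !mulr_ge0// ?cprob_ge0// mreal_ge0.
- by move=> p /pos[? ? ?]; rewrite !mulr_gt0.
- rewrite -(pair_bigA _ (fun x k => q (x, k)))/=.
  rewrite -(pair_bigA _ (fun i j => \sum_k q (i, j, k)))/=.
  rewrite exchange_big/=; under eq_bigr do rewrite exchange_big/=.
  rewrite exchange_big/= -(fpart_sum1 fC); apply: ler_sum => k _.
  apply: (@le_trans _ _ (\sum_j P (C k) * cprob mu (B j) (C k))).
    apply: ler_sum => j _; rewrite /q/= -mulr_sumr ler_piMr ?cprob_sum//.
    by rewrite mulr_ge0// ?cprob_ge0// mreal_ge0.
  by rewrite -mulr_sumr ler_piMr ?cprob_sum// mreal_ge0.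
rewrite part_entropyE /part_cond_entropy.
rewrite (@fpart_refine_sum _ _ C _ snd (fun k => ln (P (C k))) fC fABC);
  last by move=> p x [].
rewrite (@fpart_refine_sum _ _ (part_join A B) _ fst
  (fun p => ln (cprob mu (A p.1) (B p.2))) fAB fABC); last by move=> p x [].
rewrite (@fpart_refine_sum _ _ (part_join B C) _ (fun p => (p.1.2, p.2))
  (fun p => ln (cprob mu (B p.1) (C p.2))) fBC fABC); last by move=> p x [[]].
rewrite -!opprD -!big_split/= lerN2; apply: ler_sum => p _.
have := mreal_ge0 mu (part_join (part_join A B) C p).
rewrite le_eqVlt => /orP[/eqP <-|/pos[C0 BC0 AB0]]; first by rewrite !mul0r !addr0.
rewrite -!mulrDr /q !lnM ?posrE//; last by rewrite mulr_gt0.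
by rewrite -addrA (addrC (ln (cprob mu (B _) _))).
Qed.

(** The partitions [B] serve as a net and [k i] picks the net element near [A i]. The cell of the
    whole net is described once, at a cost that does not grow with [N]; each [A i] then costs only
    its conditional entropy. *)
Lemma part_entropy_cells_le (N M J : finType) (A : N -> J -> set T)
    (B : M -> J -> set T) (k : N -> M) :
  (forall i, fpart mu (A i)) -> (forall i, fpart mu (B i)) ->
  part_entropy (part_cells A) <=
    ln (#|{ffun M -> J}|%:R) + \sum_i part_cond_entropy (A i) (B (k i)).
Proof.
move=> fA fB.
have mA i : forall j, measurable (A i j) by case: (fA i).
have mB i : forall j, measurable (B i j) by case: (fB i).
have fcA := fpart_cells fA; have fcB := fpart_cells fB.
have fAB := fpart_join fcA fcB; have [mAB _ _] := fAB.
apply: (@le_trans _ _ (part_entropy (part_join (part_cells A) (part_cells B)))).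
  by apply: (@part_entropy_refine _ _ _ _ fst) => // p x [].
(* Gibbs' inequality against the law that is uniform on the cells of the B's and
   draws the atom of each A i independently, given the atom of B (k i). *)
pose c (i : N) (s t : J) := cprob mu (A i s) (B (k i) t).
pose m : R := #|{ffun M -> J}|%:R.
pose q (p : {ffun N -> J} * {ffun M -> J}) := m^-1 * \prod_i c i (p.1 i) (p.2 (k i)).
have pos p : 0 < P (part_join (part_cells A) (part_cells B) p) ->
    0 < m /\ forall i, 0 < c i (p.1 i) (p.2 (k i)).
  move=> p0; split; first by rewrite ltr0n; apply/card_gt0P; exists p.2.
  move=> i; apply: cprob_gt0 => //; apply: lt_le_trans p0 _; apply: le_mreal => //.
    exact: measurableI.
  by move=> x [Ax Bx]; split; [exact: Ax|exact: Bx].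
apply: (@le_trans _ _ _ _ _ (@gibbs _ _ q fAB _ _ _)).
- move=> p; rewrite mulr_ge0// ?invr_ge0 ?ler0n//.
  by apply: prodr_ge0 => i _; exact: cprob_ge0.
- by move=> p /pos[m0 c0]; rewrite mulr_gt0 ?invr_gt0//; apply: prodr_gt0.
- rewrite -(pair_bigA _ (fun f g => q (f, g)))/= exchange_big/=.
  apply: (@le_trans _ _ (\sum_(g : {ffun M -> J}) m^-1)).
    apply: ler_sum => g _; rewrite -mulr_sumr ler_piMr ?invr_ge0 ?ler0n//.
    rewrite -(bigA_distr_bigA (fun i s => c i s (g (k i)))).
    by apply: prodr_ile1 => i _; rewrite sumr_ge0 ?cprob_sum// => s _; exact: cprob_ge0.
  rewrite sumr_const -[leLHS]mulr_natr -/m.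
  by have [->|m0] := eqVneq m 0; rewrite ?mulr0// mulVf.
have -> : \sum_i part_cond_entropy (A i) (B (k i)) =
    - \sum_(p : {ffun N -> J} * {ffun M -> J})
        \sum_i P (part_join (part_cells A) (part_cells B) p) *
          ln (c i (p.1 i) (p.2 (k i))).
  rewrite exchange_big/= sumrN; congr (- _); apply: eq_bigr => i _.
  rewrite (@fpart_refine_sum _ _ (part_join (A i) (B (k i))) _
    (fun p : {ffun N -> J} * {ffun M -> J} => (p.1 i, p.2 (k i)))
    (fun p => ln (c i p.1 p.2)) _ fAB)//.
    exact: fpart_join.
  by move=> p x [Ax Bx]; split; [exact: Ax|exact: Bx].
have -> : ln m =
    - \sum_p P (part_join (part_cells A) (part_cells B) p) * (- ln m).
  by rewrite -mulr_suml (fpart_sum1 fAB) mul1r opprK.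
rewrite -opprD -big_split/= lerN2; apply: ler_sum => p _.
have := mreal_ge0 mu (part_join (part_cells A) (part_cells B) p).
rewrite -mulr_sumr le_eqVlt => /orP[/eqP <-|/pos[m0 c0]].
  by rewrite !mul0r addr0.
rewrite /q lnM ?posrE ?invr_gt0//; last exact: prodr_gt0.
by rewrite ln_prod// lnV ?posrE// mulrDr.
Qed.

End Entropy.

(** * Finite nets, separated sequences and diagonal subsequences *)

(** Greedy choice: when no finite family of [K] is a net, every finite family extends by an element
    at distance at least [e] from it. The later element comes first in [dist] because no symmetry is
    assumed; conditional entropy is one instance. *)
Lemma finite_net_or_separated (X : Type) (R : realType) (K : set X)
    (dist : X -> X -> R) (e : R) :
  (exists m (y : 'I_m -> X), (forall j, K (y j)) /\
     forall x, K x -> exists j, dist x (y j) < e) \/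
  (exists u : nat -> X, (forall n, K (u n)) /\
     forall m n, (m < n)%N -> e <= dist (u n) (u m)).
Proof.
apply: contrapT => /not_orP[noN]; apply.
have next m (y : 'I_m -> X) : (forall j, K (y j)) ->
    exists x, K x /\ forall j, e <= dist x (y j).
  move=> Ky; apply: contrapT => nx; apply: noN; exists m, y; split=> // x Kx.
  apply: contrapT => nj; apply: nx; exists x; split=> // j.
  by rewrite leNgt; apply/negP => xj; apply: nj; exists j.
have no0 (j : 'I_0) : False by case: j.
have [x0 _] := next 0 (fun j => False_rect X (no0 j)) (fun j => False_ind _ (no0 j)).
have /choice[f fP] (s : seq X) : exists x, (forall j, (j < size s)%N -> K (nth x0 s j)) ->
    K x /\ forall j, (j < size s)%N -> e <= dist x (nth x0 s j).
  case: (pselect (forall j, (j < size s)%N -> K (nth x0 s j))) => Ks; last by exists x0.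
  have [x [Kx xs]] := next _ (fun j : 'I_(size s) => nth x0 s j) (fun j => Ks j (ltn_ord j)).
  by exists x => _; split => // j js; exact: (xs (Ordinal js)).
pose s n := iter n (fun s => rcons s (f s)) [::].
have sz n : size (s n) = n by elim: n => //= n IH; rewrite size_rcons IH.
have sn n j : (j < n)%N -> nth x0 (s n) j = f (s j).
  elim: n => // n IH; rewrite ltnS leq_eqVlt /= nth_rcons sz => /orP[/eqP ->|jn].
    by rewrite ltnn eqxx.
  by rewrite jn IH.
have Ks n : K (f (s n)).
  elim/ltn_ind: n => n IH; apply: (fP (s n) _).1 => j; rewrite sz => jn.
  by rewrite sn//; exact: IH.
exists (f \o s); split=> // m n mn /=.
rewrite -(sn n m mn); apply: (fP (s n) _).2; rewrite sz// => j jn.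
by rewrite sn.
Qed.

(** Total boundedness is phrased by finite colourings of the indices. Pigeonhole gives nested
    infinite sets [J k] on which distances are below [2^-1 ^+ k], and the subsequence takes its
    [k]-th term from [J k]. *)
Lemma totally_bounded_subseq (R : realType) (dist : nat -> nat -> R) :
  (forall e : R, 0 < e -> exists (C : finType) (c : nat -> C),
     forall n n', c n = c n' -> dist n n' < e) ->
  exists phi : nat -> nat, (forall m n, (m < n)%N -> (phi m < phi n)%N) /\
    forall k k', (k <= k')%N -> dist (phi k) (phi k') < 2^-1 ^+ k.
Proof.
move=> tb.
pose inf (I : set nat) := forall N, exists n, (N <= n)%N /\ I n.
have shrink (kI : nat * set nat) : exists J : set nat, inf kI.2 ->
    [/\ J `<=` kI.2, inf J & forall n n', J n -> J n' -> dist n n' < 2^-1 ^+ kI.1].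
  case: kI => k I /=; have [|C [c cP]] := tb (2^-1 ^+ k); first by rewrite exprn_gt0.
  case: (pselect (inf I)) => [infI|]; last by exists I.
  suff [c0 infc] : exists c0, inf [set n | I n /\ c n = c0].
    exists [set n | I n /\ c n = c0] => _; split=> //; first by move=> n [].
    by move=> n n' [_ <-] [_ cn']; apply: cP.
  apply: contrapT => nc.
  have /choice[N NP] : forall c0, exists N, forall n, (N <= n)%N -> I n -> c n <> c0.
    move=> c0; apply: contrapT => cN; apply: nc; exists c0 => N.
    apply: contrapT => Nn; apply: cN; exists N => n Nle In cn.
    by apply: Nn; exists n.
  have [n [nN In]] := infI (\max_c0 N c0)%N.
  by apply: (NP (c n) n _ In erefl); apply: leq_trans nN; exact: leq_bigmax.
have {shrink}/choice[S SP] := shrink.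
pose J := fix J k := if k is k'.+1 then S (k, J k') else S (0%N, setT).
have infJ k : inf (J k).
  elim: k => [|k IH] /=.
    have iT : inf [set: nat] by move=> N; exists N.
    by have [_ ? _] := SP (0%N, setT) iT.
  by have [_ ? _] := SP (k.+1, J k) IH.
have Jdist k n n' : J k n -> J k n' -> dist n n' < 2^-1 ^+ k.
  case: k => [|k] /=.
    have iT : inf [set: nat] by move=> N; exists N.
    by have [_ _] := SP (0%N, setT) iT; exact.
  by have [_ _] := SP (k.+1, J k) (infJ k); exact.
have Jdecr k k' : (k <= k')%N -> J k' `<=` J k.
  elim: k' => [|k' IH]; first by rewrite leqn0 => /eqP ->.
  rewrite leq_eqVlt => /orP[/eqP -> //|/IH]; apply: subset_trans.
  by have [? _ _] := SP (k'.+1, J k') (infJ k').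
have /choice[g gP] : forall kN : nat * nat, exists n, (kN.2 <= n)%N /\ J kN.1 n.
  by move=> [k N]; exact: infJ.
pose phi := fix phi k := if k is k'.+1 then g (k, (phi k').+1) else g (0, 0)%N.
have Jphi k : J k (phi k).
  by case: k => [|k]; [exact: (gP (0, 0)%N).2|exact: (gP (k.+1, (phi k).+1)).2].
exists phi; split=> [m n|k k' kk'].
  elim: n => // n IH; rewrite ltnS leq_eqVlt => mn.
  have phin : (phi n < phi n.+1)%N by exact: (gP (n.+1, (phi n).+1)).1.
  by case/orP: mn => [/eqP -> //|/IH]; move/ltn_trans; exact.
by apply: (Jdist k) => //; exact: (Jdecr k k' kk').
Qed.

(** * Limits of sets in measure *)

Section Rokhlin.
Context {d : measure_display} {T : measurableType d} {R : realType}.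
Variable mu : probability T R.
Local Notation P := (mreal mu).

(** A limit candidate defined pointwise: disjointness of atoms passes to it exactly, not only up to
    null sets. *)
Definition set_liminf (A : nat -> set T) : set T :=
  \bigcup_N \bigcap_n A (N + n)%N.

Lemma measurable_set_liminf (A : nat -> set T) :
  (forall n, measurable (A n)) -> measurable (set_liminf A).
Proof.
by move=> mA; apply: bigcup_measurable => N _; apply: bigcap_measurable => // n _.
Qed.

(** A point whose membership never changes from index [n] on lies in the lower limit exactly when it
    lies in [A n]. *)
Lemma symdiff_set_liminf (A : nat -> set T) n :
  symdiff (A n) (set_liminf A) `<=` \bigcup_k symdiff (A (n + k)%N) (A (n + k).+1).
Proof.
move=> x nx; apply: contrapT => nk.
have AA k : A (n + k)%N x <-> A n x.
  elim: k => [|k IH]; first by rewrite addn0.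
  rewrite addnS -IH; split=> Ax; apply: contrapT => nAx; apply: nk; exists k => //.
  - by right; split.
  - by left; split.
case: nx => -[].
- move=> Ax; apply; exists n => // k _; exact/AA.
- move=> [N _ /(_ n I)] ANn; apply; move: ANn; rewrite addnC; exact: (AA N).1.
Qed.

Lemma mreal_symdiff_liminf (A : nat -> set T) n :
  (forall n, measurable (A n)) ->
  (forall n, P (symdiff (A n) (A n.+1)) <= 2^-1 ^+ n) ->
  P (symdiff (A n) (set_liminf A)) <= 2 * 2^-1 ^+ n.
Proof.
move=> mA AP; have mL := measurable_set_liminf mA.
have mS k : measurable (symdiff (A k) (A k.+1)) by exact: measurable_symdiff.
rewrite -lee_fin -(mrealE mu (measurable_symdiff (mA n) mL)).
have := measure_sigma_subadditive mu (fun k => mS (n + k)%N)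
  (measurable_symdiff (mA n) mL) (@symdiff_set_liminf A n).
move=> /le_trans; apply.
(* The bound [2^-1 ^+ (n + k)] is rewritten as [eps / 2 ^ k.+1] with [eps = 2 * 2^-1 ^+ n], whose
   series [epsilon_trick0] bounds by [eps]. *)
apply: (@le_trans _ _ (\sum_(0 <= k <oo) ((2 * 2^-1 ^+ n) / (2 ^ k.+1)%:R)%:E)%E).
  apply: lee_nneseries => // k _; have := mrealE mu (mS (n + k)%N) => /= ->.
  rewrite lee_fin.
  apply: le_trans (AP _) _; rewrite exprD natrX -exprVn exprS.
  by rewrite le_eqVlt; apply/orP; left; apply/eqP; field.
apply: epsilon_trick0; rewrite mulr_ge0//.
Qed.
End Rokhlin.

Lemma cvg0_le_geometric (R : realType) (v : nat -> R) (C : R) :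
  (forall n, 0 <= v n <= C * 2^-1 ^+ n) -> v @ \oo --> (0 : R).
Proof.
move=> vC; apply: (@squeeze_cvgr _ _ _ _ (fun=> 0) (geometric C 2^-1)).
- by apply: nearW => n; exact: vC.
- exact: cvg_cst.
- by apply: cvg_geometric; rewrite ger0_norm//; lra.
Qed.

(** * From Rokhlin precompactness to zero pattern entropy *)

Section PatternEntropy.
Context {d : measure_display} {T : measurableType d} {R : realType}.
Variable mu : probability T R.
Local Notation P := (mreal mu).

Lemma cond_entropyE (r s : nat) (a : 'I_r -> set T) (b : 'I_s -> set T) :
  fpart mu a -> fpart mu b -> cond_entropy mu a b = part_cond_entropy mu a b.
Proof.
move=> [ma _ _] [mb _ _]; rewrite /cond_entropy /part_cond_entropy.
rewrite -(pair_bigA _ (fun i j => P (a i `&` b j) * ln (cprob mu (a i) (b j))))/=.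
rewrite exchange_big/= -sumrN; apply: eq_bigr => j _.
rewrite mulr_sumr -sumrN; apply: eq_bigr => i _.
by rewrite plogpE mulrN mulrA cprob_mul.
Qed.

Variable r : nat.
Implicit Types (a b : 'I_r -> set T) (K : set ('I_r -> set T)).

Lemma rokhlin_ge0 a b : fpart mu a -> fpart mu b -> 0 <= rokhlin mu a b.
Proof.
by move=> fa fb; rewrite /rokhlin !cond_entropyE// addr_ge0// part_cond_entropy_ge0.
Qed.

Lemma rokhlin_precompact_join_entropy K : K `<=` partitions (r := r) mu ->
  rokhlin_precompact mu K -> forall e : R, 0 < e -> exists2 C : R, 0 <= C &
    forall n (al : 'I_n -> 'I_r -> set T), (forall i, K (al i)) ->
      join_entropy mu al <= C + n%:R * e.
Proof.
move=> Kp preK e e0.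
have [[m [y [Ky yP]]]|[u [Ku uP]]] := finite_net_or_separated K (@cond_entropy _ _ mu r r) e.
- exists (`|ln (#|{ffun 'I_m -> 'I_r}|%:R)|) => // n al Kal.
  have /choice[k kP] i : exists j, cond_entropy mu (al i) (y j) < e by exact: yP.
  have fal i : fpart mu (al i) by exact: Kp.
  have fy j : fpart mu (y j) by exact: Kp.
  apply: le_trans (part_entropy_cells_le k fal fy) _.
  apply: lerD; first exact: ler_norm.
  apply: (@le_trans _ _ (\sum_(i < n) e)).
    by apply: ler_sum => i _; rewrite -cond_entropyE// ltW.
  by rewrite sumr_const card_ord mulr_natl.
- have [phi [phiS [b pb]]] := preK u Ku.
  have e2 : 0 < e / 2 by rewrite divr_gt0.
  move=> /cvgr0Pnorm_lt /(_ _ e2) [N _ NP].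
  have fu n : fpart mu (u n) by exact: Kp.
  have close n : (N <= n)%N -> rokhlin mu (u (phi n)) b < e / 2.
    by move=> /NP /=; apply: le_lt_trans; exact: ler_norm.
  have := uP _ _ (phiS _ _ (ltnSn N)); rewrite leNgt => /negP; case.
  rewrite cond_entropyE//.
  (* The triangle inequality through [b] uses one summand of each Rokhlin distance, and both are
     below [e / 2]. *)
  apply: le_lt_trans (part_cond_entropy_triangle (fu _) pb (fu _)) _.
  rewrite (splitr e); apply: ltrD.
  + apply: le_lt_trans (close N.+1 (leqnSn N)).
    by rewrite /rokhlin !cond_entropyE// lerDl part_cond_entropy_ge0.
  + apply: le_lt_trans (close N (leqnn N)).
    by rewrite /rokhlin !cond_entropyE// lerDr part_cond_entropy_ge0.
Qed.

Lemma pattern_entropy_ge0 K n : (0 <= pattern_entropy mu K n)%E.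
Proof. by apply: ereal_sup_ubound; left. Qed.

(** After division by [n] the term from [C] tends to 0, which leaves the slope [e], and [e] is
    arbitrary. *)
Lemma max_pattern_entropy_eq0 K :
  (forall e : R, 0 < e -> exists2 C : R, 0 <= C &
    forall n (al : 'I_n -> 'I_r -> set T), (forall i, K (al i)) ->
      join_entropy mu al <= C + n%:R * e) ->
  max_pattern_entropy mu K = 0%E.
Proof.
move=> bnd.
have pbnd e C : 0 <= C -> 0 < e ->
    (forall n (al : 'I_n -> 'I_r -> set T), (forall i, K (al i)) ->
      join_entropy mu al <= C + n%:R * e) ->
    forall n, (pattern_entropy mu K n <= (C + n%:R * e)%:E)%E.
  move=> C0 e0 CP n; apply: ge_ereal_sup => x [->|[al Kal <-]]; rewrite lee_fin.
    by rewrite addr_ge0// mulr_ge0// ltW.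
  exact: CP.
pose p n := fine (pattern_entropy mu K n).
have pE n : pattern_entropy mu K n = (p n)%:E.
  rewrite fineK// ge0_fin_numE ?pattern_entropy_ge0//.
  (* The case [e = 1] already makes every [pattern_entropy] finite. *)
  have [C C0 CP] := bnd _ (@ltr01 R).
  by apply: le_lt_trans (pbnd _ _ C0 ltr01 CP n) _; rewrite ltry.
have p0 n : 0 <= p n by rewrite -lee_fin -pE pattern_entropy_ge0.
have -> : max_pattern_entropy mu K = limn_esup (fun n => (n%:R^-1 * p n)%:E).
  by congr limn_esup; apply/funext => n; rewrite pE.
apply: (cvg_limn_einf_sup _).2; apply: cvg_EFin; first exact: nearW.
apply/cvgr0Pnorm_lt => e e0.
have e2 : 0 < e / 2 by rewrite divr_gt0.
have [C C0 CP] := bnd _ e2.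
near=> n; rewrite /= ger0_norm ?mulr_ge0 ?invr_ge0//.
have n0 : (0 : R) < n%:R by near: n; exact: nbhs_infty_gtr.
rewrite mulrC ltr_pdivrMr// (@le_lt_trans _ _ (C + n%:R * (e / 2)))//.
  by rewrite -lee_fin -pE; exact: pbnd.
have nC : C / (e / 2) < n%:R by near: n; exact: nbhs_infty_gtr.
move: nC; rewrite ltr_pdivrMr// => nC; rewrite {2}(splitr e) mulrDl.
by rewrite ![_ / 2 * _]mulrC ltrD2r.
Unshelve. all: by end_near.
Qed.

(** * From zero pattern entropy to precompactness of the indicators in L^2 *)

Lemma max_pattern_entropy_conditional K : K `<=` partitions (r := r) mu ->
  max_pattern_entropy mu K = 0%E -> forall e : R, 0 < e ->
  exists n (al : 'I_n -> 'I_r -> set T), (forall i, K (al i)) /\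
    forall b, K b -> part_cond_entropy mu b (part_cells al) < e.
Proof.
move=> Kp K0 e e0; apply: contrapT => nal.
have large n : exists al : 'I_n -> 'I_r -> set T, (forall i, K (al i)) /\
    n%:R * e <= join_entropy mu al.
  elim: n => [|n [al [Kal alP]]].
    have al0 : 'I_0 -> 'I_r -> set T by case.
    exists al0; split; first by case.
    rewrite mul0r; apply: part_entropy_ge0; apply: fpart_cells; by case.
  have [b Kb eb] : exists2 b, K b & e <= part_cond_entropy mu b (part_cells al).
    apply: contrapT => nb; apply: nal; exists n, al; split => // b Kb.
    by rewrite ltNge; apply/negP => eb; apply: nb; exists b.
  pose al' (i : 'I_n.+1) := if unlift ord_max i is Some j then al j else b.
  have Kal' i : K (al' i) by rewrite /al'; case: unliftP.
  exists al'; split => //.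
  have fcal : fpart mu (part_cells al) by apply: fpart_cells => i; exact: Kp.
  have fb : fpart mu b by exact: Kp.
  rewrite -natr1 mulrDl mul1r.
  apply: (@le_trans _ _ (part_entropy mu (part_join b (part_cells al)))).
    by rewrite part_entropy_join// lerD.
  apply: (@part_entropy_refine _ _ _ _ _ _ _ _ (fun f : {ffun 'I_n.+1 -> 'I_r} =>
    (f ord_max, [ffun i => f (lift ord_max i)]))).
  - exact: fpart_join.
  - by apply: fpart_cells => i; exact: Kp.
  - move=> f x fx; split => /=.
      by have := fx ord_max I; rewrite /al' unlift_none.
    by move=> i _; rewrite ffunE; have := fx (lift ord_max i) I; rewrite /al' liftK.
(* A nonnegative sequence with limit superior 0 converges to 0. *)
have u0 : (fun n => ((n%:R : R)^-1)%:E * pattern_entropy mu K n)%E @ \oo --> 0%E.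
  apply: limn_esup_le_cvg; first by rewrite -K0.
  by move=> n; rewrite mule_ge0 ?pattern_entropy_ge0// lee_fin invr_ge0.
have [N _ NP] : \forall n \near \oo, (((n%:R : R)^-1)%:E * pattern_entropy mu K n < e%:E)%E.
  have [fin /cvgr0Pnorm_lt /(_ _ e0) small] := (fine_cvgP _ _).1 u0.
  near=> n; rewrite -[ltLHS]fineK; last by near: n; exact: fin.
  rewrite lte_fin; apply: le_lt_trans (ler_norm _) _; near: n; exact: small.
have := NP N.+1 (leqnSn N) => /=; rewrite ltNge => /negP; apply.
rewrite muleC lee_pdivlMr ?ltr0n//.
have [al [Kal alP]] := large N.+1.
apply: le_trans (ereal_sup_ubound _); last by right; exists al.
by rewrite -EFinM lee_fin mulrC.
Unshelve. all: by end_near.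
Qed.

(* With c = P(A j | B i), the error on the cell B i is min(c, 1 - c), which is at
   most 2c(1 - c) <= - 2c ln c. *)
Lemma fpart_symdiff_approx (I J : finType) (A : J -> set T) (B : I -> set T) j :
  fpart mu A -> fpart mu B ->
  P (symdiff (A j) (\bigcup_(i in [set i | 2^-1 < cprob mu (A j) (B i)]) B i)) <=
    2 * part_cond_entropy mu A B.
Proof.
move=> fA fB; have [mA _ _] := fA; have [mB dB _] := fB.
set U := bigcup _ _; have mU : measurable U by exact: measurable_bigcup_fin.
have mAU := measurable_symdiff (mA j) mU.
rewrite (mreal_fpart fB mAU).
apply: (@le_trans _ _ (\sum_i 2 * (- (P (A j `&` B i) * ln (cprob mu (A j) (B i)))))).
  apply: ler_sum => i _; set c := cprob mu (A j) (B i).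
  apply: (@le_trans _ _ (2 * (P (A j `&` B i) * (1 - c)))); last first.
    rewrite ler_pM2l// -mulrN.
    have := mreal_ge0 mu (A j `&` B i); rewrite le_eqVlt => /orP[/eqP <-|AB0].
      by rewrite !mul0r.
    rewrite ler_pM2l// lerNr opprB; apply: ln_le_subr1; exact: cprob_gt0.
  have c1 : c <= 1 by exact: cprob_le1.
  have [c2|c2] := ltrP 2^-1 c.
    apply: (@le_trans _ _ (P (B i `\` A j))).
      apply: le_mreal; [exact: measurableI|exact: measurableD|].
      move=> x [[[Ax nUx]|[Ux nAx]] Bx]; last by split.
      by case: nUx; exists i.
    have := mreal_setDI mu (mB i) (mA j); rewrite setIC -cprob_mul// -/c.
    move=> /eqP; rewrite -subr_eq => /eqP <-.
    have := mreal_ge0 mu (B i); set p := P (B i) => p0.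
    have -> : p - p * c = p * (1 - c) by ring.
    have -> : 2 * (p * c * (1 - c)) = p * (1 - c) * (2 * c) by ring.
    apply: ler_peMr; [by rewrite mulr_ge0// subr_ge0|lra].
  apply: (@le_trans _ _ (P (A j `&` B i))).
    apply: le_mreal; [exact: measurableI|exact: measurableI|].
    move=> x [[[Ax nUx]|[[k /= ck Bkx] nAx]] Bx]; first by split.
    exfalso; have [ki|ki] := eqVneq k i.
      by move: ck; rewrite ki -/c ltNge c2.
    by have : (B k `&` B i) x by []; rewrite dB.
  rewrite mulrCA; apply: ler_peMr; [exact: mreal_ge0|lra].
rewrite -mulr_sumr ler_pM2l// /part_cond_entropy -sumrN.
rewrite -(pair_bigA _ (fun j i => - (P (A j `&` B i) * ln (cprob mu (A j) (B i)))))/=.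
rewrite [leRHS](bigD1 j)//= lerDl; apply: sumr_ge0 => k _; apply: sumr_ge0 => i _.
rewrite oppr_ge0 mulr_ge0_le0 ?mreal_ge0//; exact/ln_le0/cprob_le1.
Qed.

Lemma L2dist2_indic (A B : set T) : measurable A -> measurable B ->
  L2dist2 mu \1_A \1_B = mu (symdiff A B).
Proof.
move=> mA mB; rewrite /L2dist2.
transitivity (\int[mu]_x (\1_(symdiff A B) x)%:E)%E.
  apply: eq_integral => x _; congr _%:E; rewrite !indicE /symdiff in_setU !in_setD.
  by case: (x \in A); case: (x \in B) => /=;
    rewrite ?subrr ?subr0 ?sub0r ?sqrrN ?expr0n ?expr1n.
rewrite integral_indic ?setIT//; exact: measurable_symdiff.
Qed.

(** Each atom is coloured by the cells of a finite join of which it fills more than half; two atoms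
    of the same colour are near the same union of cells. The limit is supplied by [set_liminf], so
    it is again an indicator. *)
Lemma max_pattern_entropy_L2_precompact K : K `<=` partitions (r := r) mu ->
  max_pattern_entropy mu K = 0%E -> L2_precompact mu (atom_indicators (R := R) K).
Proof.
move=> Kp K0 f fK.
have /choice[ai aiP] n : exists ai : ('I_r -> set T) * 'I_r, K ai.1 /\ f n = \1_(ai.1 ai.2).
  by have [a [i aiP]] := fK n; exists (a, i).
pose A n := (ai n).1 (ai n).2.
have fai n : fpart mu (ai n).1 by apply: Kp; case: (aiP n).
have mA n : measurable (A n) by have [mai _ _] := fai n; exact: mai.
have [|phi [phiS phiP]] := @totally_bounded_subseq R (fun n n' => P (symdiff (A n) (A n'))).
  (* [fpart_symdiff_approx] doubles [e / 4], and comparing two atoms involves two such errors. *)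
  move=> e e0; have e4 : 0 < e / 4 by rewrite divr_gt0.
  have [m [al [Kal alP]]] := max_pattern_entropy_conditional Kp K0 e4.
  have fal : fpart mu (part_cells al) by apply: fpart_cells => i; exact: Kp.
  have [mal _ _] := fal.
  pose c n := finset (fun g => 2^-1 < cprob mu (A n) (part_cells al g)).
  exists {set {ffun 'I_m -> 'I_r}}, c => n n' cn.
  pose U n := \bigcup_(g in [set g | 2^-1 < cprob mu (A n) (part_cells al g)]) part_cells al g.
  have mU k : measurable (U k) by exact: measurable_bigcup_fin.
  have UU : U n = U n'.
    rewrite /U; congr bigcup; apply/funext => g; congr is_true.
    by have /setP/(_ g) := cn; rewrite !inE.
  have AU k : P (symdiff (A k) (U k)) < e / 2.
    apply: le_lt_trans (fpart_symdiff_approx _ (fai k) fal) _.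
    have := alP _ (aiP k).1; lra.
  apply: le_lt_trans (mreal_symdiff_triangle mu (mA n) (mU n) (mA n')) _.
  by rewrite (splitr e) ltrD// UU symdiffC.
exists phi; split => //; pose L := set_liminf (A \o phi).
have mL : measurable L by apply: measurable_set_liminf => n; exact: mA.
exists \1_L; split.
- exact: measurable_indic.
- rewrite (eq_integral (fun x => (\1_L x)%:E)); last first.
    by move=> x _; rewrite indicE; case: (x \in L); rewrite ?expr0n ?expr1n.
  rewrite integral_indic// setIT; apply: le_lt_trans (probability_le1 mu mL) _.
  by rewrite ltry.
have mAL n : measurable (symdiff (A (phi n)) L) by exact: measurable_symdiff.
have -> : (fun n => L2dist2 mu (f (phi n)) \1_L) =
    (fun n => (P (symdiff (A (phi n)) L))%:E).
  apply/funext => n; rewrite (aiP (phi n)).2 L2dist2_indic.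
  - exact: (mrealE mu (mAL n)).
  - exact: mA.
  - exact: mL.
apply: cvg_EFin; first exact: nearW.
apply: (@cvg0_le_geometric _ _ 2) => n; rewrite mreal_ge0/=.
apply: (@mreal_symdiff_liminf _ _ _ mu (A \o phi)) => k /=; first exact: mA.
by apply/ltW/phiP.
Qed.

End PatternEntropy.

(** * Counting the members of a finite family that contain a point *)

(** Its nonempty fibres are the atoms of the algebra generated by [F], and its cardinality is the
    counting function of the family. *)
Definition signature (T : Type) (I : finType) (F : I -> set T) (x : T) : {set I} :=
  finset (fun i => `[< F i x >]).

Lemma eq_signature (T : Type) (I : finType) (F : I -> set T) (x y : T) :
  signature F x = signature F y -> forall i, F i x <-> F i y.
Proof.
move=> xy i; have /setP/(_ i) := xy; rewrite !inE => e.
by split=> [/asboolP|/asboolP]; [rewrite e|rewrite -e] => /asboolP.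
Qed.

Section Signature.
Context {d : measure_display} {T : measurableType d} {R : realType}.
Variable mu : probability T R.
Local Notation P := (mreal mu).
Variables (I : finType) (F : I -> set T).
Hypothesis mF : forall i, measurable (F i).

Definition signature_cell (S : {set I}) : set T := [set x | signature F x = S].

Lemma measurable_signature_cell S : measurable (signature_cell S).
Proof.
rewrite (_ : signature_cell S = \bigcap_i (if i \in S then F i else ~` F i)).
  apply: measurable_bigcap_fin => i; case: ifP => _ //; exact: measurableC.
apply/seteqP; split=> x /=.
  by move=> <- i _; rewrite inE; case: ifP => [/asboolP|/negbT/asboolPn].
move=> xS; apply/setP => i; rewrite inE; have := xS i Logic.I; case: ifP => _ Fi.
  exact/asboolP.
exact/negbTE/asboolPn.
Qed.

(** Such a set is a union of finitely many signature cells. Hamming balls and sets cut out by counts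
    are measurable for this reason. *)
Lemma measurable_signature_invariant (A : set T) :
  (forall x y, signature F x = signature F y -> A x -> A y) -> measurable A.
Proof.
move=> Ainv.
rewrite (_ : A = \bigcup_(S in [set S | exists2 x, A x & signature F x = S]) signature_cell S).
  apply: measurable_bigcup_fin; exact: measurable_signature_cell.
apply/seteqP; split=> [x Ax|x [S [y Ay yS] xS]].
  by exists (signature F x) => //; exists x.
by apply: Ainv Ay; rewrite yS.
Qed.

Lemma fpart_signature : fpart mu signature_cell.
Proof.
split; first exact: measurable_signature_cell.
  move=> S S' /eqP SS'; rewrite -subset0 => x [xS xS'].
  by apply: SS'; exact: etrans (esym xS) xS'.
rewrite (_ : ~` _ = set0) ?measure0// -subset0 => x; apply.
by exists (signature F x).
Qed.

(** Double counting: both sides are the integral of the counting function, which is constant on each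
    signature cell. *)
Lemma sum_mreal_signature :
  \sum_i P (F i) = \sum_S P (signature_cell S) * #|S|%:R.
Proof.
under eq_bigr => i _ do rewrite (mreal_fpart fpart_signature (mF i)).
rewrite exchange_big/=; apply: eq_bigr => S _.
rewrite -sum1_card natr_sum mulr_sumr [RHS]big_mkcond/=.
apply: eq_bigr => i _; case: ifPn => iS.
  rewrite mulr1; congr mreal; apply: setIidr => x xS.
  by apply/asboolP; move: iS; rewrite -(xS : _ = S) inE.
rewrite (_ : _ `&` _ = set0) ?mreal0// -subset0 => x [Fx xS].
by move: iS; rewrite -(xS : _ = S) inE => /asboolP.
Qed.

Lemma mreal_count_markov (t : R) :
  t * P [set x | t <= #|signature F x|%:R] <= \sum_i P (F i).
Proof.
rewrite sum_mreal_signature; set M := [set x | _].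
have mM : measurable M.
  by apply: measurable_signature_invariant => x y; rewrite /M/= => ->.
rewrite (mreal_fpart fpart_signature mM) mulr_sumr; apply: ler_sum => S _.
have [tS|St] := lerP t #|S|%:R.
  have [t0|t0] := lerP 0 t.
    rewrite mulrC ler_pM ?mreal_ge0//; apply: le_mreal => //.
    - by apply: measurableI => //; exact: measurable_signature_cell.
    - exact: measurable_signature_cell.
  rewrite (@le_trans _ _ 0)//; last by rewrite mulr_ge0// mreal_ge0.
  by rewrite mulr_le0_ge0 ?mreal_ge0// ltW.
rewrite (_ : M `&` _ = set0) ?mreal0 ?mulr0; first by rewrite mulr_ge0// mreal_ge0.
by rewrite -subset0 => x []; rewrite /M /signature_cell/= => + xS; rewrite xS leNgt St.
Qed.

(** A signature cell inside [V] has count at most [#|I|]; any other contains a point off [V], so its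
    count is at most [t]. *)
Lemma sum_mreal_count_le (V : set T) (t : R) : measurable V -> 0 <= t ->
  (forall x, ~ V x -> #|signature F x|%:R <= t) ->
  \sum_i P (F i) <= t + #|I|%:R * P V.
Proof.
move=> mV t0 Vt; rewrite sum_mreal_signature.
rewrite (mreal_fpart fpart_signature mV) mulr_sumr.
have {1}-> : t = \sum_S t * P (signature_cell S).
  by rewrite -mulr_sumr (fpart_sum1 fpart_signature) mulr1.
rewrite -big_split/=.
apply: ler_sum => S _; have mS := measurable_signature_cell S.
have [SV|] := pselect (signature_cell S `<=` V).
  rewrite (setIidr SV) -mulrDl mulrC ler_wpM2r ?mreal_ge0//.
  apply: (@le_trans _ _ #|I|%:R); first by rewrite ler_nat max_card.
  by rewrite lerDr.
move=> nSV; have [x [xS nVx]] : exists x, signature F x = S /\ ~ V x.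
  apply: contrapT => nx; apply: nSV => x xS; apply: contrapT => nVx.
  by apply: nx; exists x.
rewrite (@le_trans _ _ (t * P (signature_cell S)))//.
  by rewrite mulrC ler_wpM2r ?mreal_ge0// -xS; exact: Vt.
by rewrite lerDl mulr_ge0// mreal_ge0.
Qed.

End Signature.

Lemma hammingE (T : Type) (R : realType) (r n : nat) (e : 'I_n -> 'I_r -> set T) x y :
  hamming R e x y = n%:R^-1 * #|finset (fun i => `[< sep_by (e i) x y >])|%:R.
Proof.
congr (_ * _%:R); apply: eq_card => i; rewrite finset.inE.
by apply/idP/idP => [/set_mem|] //= h; apply/mem_set.
Qed.

(** * From precompactness in L^2 to bounded mean complexity *)

Section MeanComplexity.
Context {d : measure_display} {T : measurableType d} {R : realType}.
Variable mu : probability T R.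
Local Notation P := (mreal mu).

(** Pointwise [(p - q)^2 <= 2 p^2 + 2 q^2] with [p = f - g] and [q = h - g]. This replaces the
    triangle inequality, since the distances are squared. *)
Lemma L2dist2_le (f g h : T -> R) : measurable_fun setT f ->
  measurable_fun setT g -> measurable_fun setT h ->
  (L2dist2 mu f h <= 2%:E * L2dist2 mu f g + 2%:E * L2dist2 mu h g)%E.
Proof.
move=> mf mg mh; rewrite /L2dist2.
have msq (u v : T -> R) : measurable_fun setT u -> measurable_fun setT v ->
    measurable_fun setT (fun x => ((u x - v x) ^+ 2)%:E).
  move=> mu' mv; apply/measurable_EFinP; apply: measurable_funX.
  exact: measurable_funB.
rewrite -!ge0_integralZl_EFin//; try exact: msq; last 2 first.
- by move=> x _; rewrite lee_fin sqr_ge0.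
- by move=> x _; rewrite lee_fin sqr_ge0.
rewrite -ge0_integralD//; last 4 first.
- by move=> x _; rewrite -EFinM lee_fin mulr_ge0// sqr_ge0.
- by apply: measurable_funeM; exact: msq.
- by move=> x _; rewrite -EFinM lee_fin mulr_ge0// sqr_ge0.
- by apply: measurable_funeM; exact: msq.
apply: ge0_le_integral => //.
- by move=> x _; rewrite lee_fin sqr_ge0.
- exact: msq.
- by apply: emeasurable_funD; apply: measurable_funeM; exact: msq.
- move=> x _; rewrite -!EFinM -EFinD lee_fin.
  have := sqr_ge0 (f x - g x + (h x - g x)); nra.
Qed.

Variable r : nat.
Implicit Types (a b : 'I_r -> set T) (K : set ('I_r -> set T)).

(** An [e]-separated sequence of atoms has no subsequence whose indicators converge in L^2. The
    limit [g] need not be an indicator, so two terms are compared through [L2dist2_le] instead of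
    symmetric differences. *)
Lemma L2_precompact_net K : K `<=` partitions (r := r) mu ->
  L2_precompact mu (atom_indicators (R := R) K) -> forall e : R, 0 < e ->
  exists m (F : 'I_m -> set T), (forall j, measurable (F j)) /\
    forall a i, K a -> exists j, P (symdiff (a i) (F j)) < e.
Proof.
move=> Kp preK e e0.
pose KA := [set A : set T | exists a i, K a /\ A = a i].
have mKA A : KA A -> measurable A.
  by move=> [a [i [/Kp[ma _ _] ->]]]; exact: ma.
have [[m [F [KF FP]]]|[u [Ku uP]]] :=
    finite_net_or_separated KA (fun A B => P (symdiff A B)) e.
  exists m, F; split=> [j|a i Ka]; first exact: mKA.
  by apply: FP; exists a, i.
have mu_ n : measurable (u n) by exact: mKA.
have [n|phi [phiS [g [mg _ cvg_g]]]] := preK (fun n => \1_(u n)).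
  by have [a [i [Ka ->]]] := Ku n; exists a, i.
(* Two terms will be within [e / 4] of [g], and each distance enters with the factor 2. *)
have e4 : 0 < e / 4 by rewrite divr_gt0.
have [fin /cvgr0Pnorm_lt /(_ _ e4) small] := (fine_cvgP _ _).1 cvg_g.
have [N _ NP] : \forall n \near \oo, (L2dist2 mu \1_(u (phi n)) g < (e / 4)%:E)%E.
  near=> n; rewrite -[ltLHS]fineK; last by near: n; exact: fin.
  rewrite lte_fin; apply: le_lt_trans (ler_norm _) _; near: n; exact: small.
have := uP _ _ (phiS _ _ (ltnSn N)); rewrite leNgt => /negP; case.
have mS : measurable (symdiff (u (phi N.+1)) (u (phi N))) by exact: measurable_symdiff.
rewrite -lte_fin -(mrealE mu mS) -L2dist2_indic//.
have mi n : measurable_fun setT (\1_(u n) : T -> R) by exact: measurable_indic.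
apply: le_lt_trans (L2dist2_le (mi _) mg (mi _)) _.
have -> : e = 2 * (e / 4) + 2 * (e / 4) by field.
by rewrite [X in (_ < X)%E]EFinD !EFinM; apply: lteD; rewrite lte_pmul2l//;
  apply: NP => /=; rewrite ?leqnSn ?leqnn.
Unshelve. all: by end_near.
Qed.

(** Whether a point lies in the ball depends only on which of the finitely many atoms contain it. *)
Lemma measurable_hball n (e : 'I_n -> 'I_r -> set T) (x : T) (eps : R) :
  (forall k i, measurable (e k i)) -> measurable (hball e x eps).
Proof.
move=> me.
apply: (@measurable_signature_invariant _ _ _ (fun ki => e ki.1 ki.2)).
  by move=> [k i]; exact: me.
move=> y z yz; rewrite /hball/= !hammingE => yeps.
suff <- : finset (fun i => `[< sep_by (e i) x y >]) =
  finset (fun i => `[< sep_by (e i) x z >]) by [].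
apply/setP => k; rewrite !finset.inE.
apply: asbool_equiv_eq.
have eyz i := eq_signature yz (k, i).
by rewrite /sep_by; split=> ns [j [? ?]]; apply: ns; exists j; split => //; exact/eyz.
Qed.

Lemma L2_precompact_mean_complexity K : K `<=` partitions (r := r) mu ->
  L2_precompact mu (atom_indicators (R := R) K) -> bounded_mean_complexity mu K.
Proof.
move=> Kp preK eps eps0.
(* With the threshold [t = n * eps / 2], Markov's inequality bounds [P M] by [2 * r * del / eps],
   which is [eps * r / r.+1 < eps]. *)
pose del : R := eps ^+ 2 / (2 * r.+1%:R).
have del0 : 0 < del by rewrite divr_gt0 ?exprn_gt0 ?mulr_gt0 ?ltr0n.
have [m [F [mF FP]]] := L2_precompact_net Kp preK del0.
(* One centre for each pattern of membership in the net; this number does not depend on [n]. *)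
exists #|{set 'I_m}| => n e n0 _ Ke.
have fe k : fpart mu (e k) by exact: Kp.
have me k i : measurable (e k i) by have [mek _ _] := fe k; exact: mek.
have mUe k : measurable (\bigcup_i e k i) by exact: measurable_bigcup_fin.
have /choice[c cP] : forall ki : 'I_n * 'I_r, exists j,
    P (symdiff (e ki.1 ki.2) (F j)) < del by move=> [k i]; exact: FP.
have mD k i : measurable (symdiff (e k i) (F (c (k, i)))) by exact: measurable_symdiff.
have mUD k : measurable (\bigcup_i symdiff (e k i) (F (c (k, i)))).
  exact: measurable_bigcup_fin.
(* Off [Bad k], a point lies in some atom of [e k], and its membership in each atom agrees with that
   in the approximating net set. *)
pose Bad k := (\bigcup_i symdiff (e k i) (F (c (k, i)))) `|` ~` \bigcup_i e k i.
have mBad k : measurable (Bad k) by apply: measurableU => //; exact: measurableC.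
have PBad k : P (Bad k) <= r%:R * del.
  apply: le_trans (mreal_setU mu (mUD k) (measurableC (mUe k))) _.
  rewrite [X in _ + X](_ : _ = 0); last by rewrite /mreal; have [_ _ ->] := fe k.
  rewrite addr0 (le_trans (mreal_cover_le mu (mUD k) (mD k) (@subset_refl _ _)))//.
  apply: (@le_trans _ _ (\sum_(i < r) del)).
    by apply: ler_sum => i _; exact: (ltW (cP (k, i))).
  by rewrite sumr_const card_ord mulr_natl.
(* Half of [n * eps], because a separation of two points can be charged to either of them. *)
pose t : R := n%:R * (eps / 2).
have nR : (0 : R) < n%:R by rewrite ltr0n.
have t0 : 0 < t by rewrite mulr_gt0// divr_gt0.
pose M := [set x | t <= #|signature Bad x|%:R].
have mM : measurable M.
  by apply: (@measurable_signature_invariant _ _ _ Bad) => // x y; rewrite /M/= => ->.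
have PM : P M < eps.
  rewrite -(ltr_pM2l t0); apply: le_lt_trans (mreal_count_markov mu mBad t) _.
  apply: (@le_lt_trans _ _ (\sum_(k < n) r%:R * del)); first exact: ler_sum.
  rewrite sumr_const card_ord -[ltLHS]mulr_natl /t -!mulrA ltr_pM2l// /del.
  have rr : (r%:R : R) < r.+1%:R by rewrite ltr_nat.
  have r1 : (0 : R) < r.+1%:R by rewrite ltr0n.
  have -> : r%:R * (eps ^+ 2 / (2 * r.+1%:R)) = eps * (2^-1 * eps) * (r%:R / r.+1%:R).
    by field; rewrite gt_eqF.
  by rewrite gtr_pMr ?ltr_pdivrMr ?mul1r// !mulr_gt0// invr_gt0.
have [x0 _] : exists x : T, True.
  apply: contrapT => nx; have : (0 : R) < 1 by [].
  rewrite -(mrealT mu) (_ : setT = set0) ?mreal0 ?ltxx//.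
  by rewrite -subset0 => x _; apply: nx; exists x.
(* Centres are taken outside [M]; [x0] fills in for patterns that do not occur there. *)
have /choice[rep repP] (S : {set 'I_m}) : exists x, (exists y, ~ M y /\ signature F y = S) ->
    ~ M x /\ signature F x = S.
  have [[y yP]|ny] := pselect (exists y, ~ M y /\ signature F y = S).
    by exists y.
  by exists x0.
pose D := [seq rep Q | Q : {set 'I_m}].
exists D; split; first by rewrite size_map -cardE.
have mU : measurable (\bigcup_(x in [set` D]) hball e x eps).
  apply: fin_bigcup_measurable; first exact: finite_seq.
  by move=> x _; exact: measurable_hball.
apply: (@lt_le_trans _ _ (mu (~` M))).
  rewrite (mrealE mu (measurableC mM)) lte_fin.
  have := mreal_setDI mu (@measurableT _ T) mM.
  rewrite mrealT setTI setTD; lra.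
apply: le_measure; rewrite ?inE//; first exact: measurableC.
move=> y nMy; have [nMx xy] := repP (signature F y) (ex_intro _ y (conj nMy erefl)).
set x := rep _ in nMx xy; exists x.
  by apply/mapP; exists (signature F y) => //; rewrite mem_enum.
rewrite /hball/= hammingE mulrC ltr_pdivrMr// mulrC.
apply: (@le_lt_trans _ _ (#|signature Bad x :|: signature Bad y|%:R)).
  (* A partition separating [x] and [y] is bad for [x] or for [y]: otherwise the equal signatures
     carry the atom of [x] over to [y]. *)
  rewrite ler_nat; apply/subset_leq_card/fintype.subsetP => k.
  rewrite !finset.inE => /asboolP ns.
  apply: contrapT => /negP; rewrite negb_or => /andP[/asboolPn nx /asboolPn ny].
  apply: ns; have [i _ eix] : (\bigcup_i e k i) x.
    by apply: contrapT => nex; apply: nx; right.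
  exists i; split=> //; apply: contrapT => neiy.
  have Fx : F (c (k, i)) x.
    by apply: contrapT => nFx; apply: nx; left; exists i => //; left.
  apply: ny; left; exists i => //; right; split=> //.
  exact: (eq_signature xy _).1.
apply: (@le_lt_trans _ _ (#|signature Bad x|%:R + #|signature Bad y|%:R)).
  by rewrite -natrD ler_nat cardsU leq_subr.
have -> : n%:R * eps = t + t by rewrite /t; field.
by apply: ltrD; rewrite ltNge; exact/negP.
Qed.

End MeanComplexity.

(** * From bounded mean complexity to Rokhlin precompactness *)

(** This is [mulr_ln_sub_le] at [w = c] and [q = Num.sqrt c], where [ln c] is twice [ln q]. *)
Lemma mulr_ln_le_sqrt (R : realType) (c : R) : 0 <= c ->
  - (c * ln c) <= 2 * Num.sqrt c.
Proof.
rewrite le_eqVlt => /orP[/eqP <-|c0].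
  by rewrite mul0r oppr0 mulr_ge0// sqrtr_ge0.
set s := Num.sqrt c; have s0 : 0 < s by rewrite sqrtr_gt0.
have cE : c = s * s by rewrite -expr2 sqr_sqrtr// ltW.
have := mulr_ln_sub_le (ltW c0) (ltW s0) (fun _ => s0).
rewrite cE lnM ?posrE//; have : 0 <= s * s by rewrite -cE ltW.
nra.
Qed.

Section Labelled.
Context {d : measure_display} {T : measurableType d} {R : realType}.
Variable mu : probability T R.
Local Notation P := (mreal mu).
Variable r : nat.
Implicit Types (a b : 'I_r -> set T) (K : set ('I_r -> set T)).

(* Labels are not permuted, so this is larger than the distance of the underlying
   unlabelled partitions; it still controls the Rokhlin metric. *)
Definition label_dist a b : R := \sum_i P (symdiff (a i) (b i)).

Lemma label_distC a b : label_dist a b = label_dist b a.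
Proof. by apply: eq_bigr => i _; rewrite symdiffC. Qed.

Lemma label_dist_triangle a b c :
  (forall i, measurable (a i)) -> (forall i, measurable (b i)) ->
  (forall i, measurable (c i)) ->
  label_dist a c <= label_dist a b + label_dist b c.
Proof.
move=> ma mb mc; rewrite -big_split/=; apply: ler_sum => i _.
exact: mreal_symdiff_triangle.
Qed.

Lemma label_dist_ge a b i : P (symdiff (a i) (b i)) <= label_dist a b.
Proof.
rewrite /label_dist (bigD1 i)//= lerDl; apply: sumr_ge0 => j _; exact: mreal_ge0.
Qed.

(** For [i != j], the intersection of [a i] and [b j] lies in [a i] minus [b i], and
    [mulr_ln_le_sqrt] brings in the square root of its measure. For [i = j], the bound
    [- (c * ln c) <= 1 - c] leaves the measure of [b j] minus [a j]. *)
Lemma part_cond_entropy_label_dist a b : fpart mu a -> fpart mu b ->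
  part_cond_entropy mu a b <= 2 * r%:R ^+ 2 * Num.sqrt (label_dist a b).
Proof.
move=> fa fb; have [ma da _] := fa; have [mb db _] := fb.
set D := label_dist a b.
have le_sqrt x : 0 <= x -> x <= D -> Num.sqrt x <= Num.sqrt D.
  by move=> x0 xD; rewrite ler_sqrt// (le_trans x0).
rewrite /part_cond_entropy -sumrN.
apply: (@le_trans _ _ (\sum_(p : 'I_r * 'I_r) 2 * Num.sqrt D)); last first.
  rewrite sumr_const card_prod card_ord -[leLHS]mulr_natl natrM.
  by rewrite [leLHS](_ : _ = 2 * r%:R ^+ 2 * Num.sqrt D)//; ring.
apply: ler_sum => -[i j] _; rewrite /part_join/=.
set c := cprob mu (a i) (b j).
have c0 : 0 <= c by exact: cprob_ge0.
have b0 : 0 <= P (b j) by exact: mreal_ge0.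
have b1 : P (b j) <= 1 by exact: mreal_le1.
rewrite -cprob_mul// -/c -mulrA -mulrN.
have [ij|ij] := eqVneq i j; last first.
  apply: (@le_trans _ _ (P (b j) * (2 * Num.sqrt c))).
    by rewrite ler_wpM2l// mulr_ln_le_sqrt.
  rewrite mulrCA ler_pM2l//.
  apply: (@le_trans _ _ (Num.sqrt (P (b j)) * Num.sqrt (P (b j) * c))).
    by rewrite sqrtrM// mulrA -expr2 sqr_sqrtr.
  rewrite -[leRHS]mul1r ler_pM ?sqrtr_ge0//.
    by rewrite -[leRHS](sqrtr1 R) ler_sqrt.
  rewrite cprob_mul//; apply: le_sqrt; first exact: mreal_ge0.
  apply: le_trans (label_dist_ge a b i); apply: le_mreal.
  - exact: measurableI.
  - exact: measurable_symdiff.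
  - move=> x [aix bjx]; left; split => // bix.
    by have : (b i `&` b j) x by []; rewrite db.
set x := P (b j `\` a j).
have x0 : 0 <= x by exact: mreal_ge0.
have xD : x <= D.
  apply: le_trans (label_dist_ge a b j); apply: le_mreal.
  - exact: measurableD.
  - exact: measurable_symdiff.
  - by move=> y; right.
have x1 : x <= 1 by apply: mreal_le1; exact: measurableD.
apply: (@le_trans _ _ x).
  have -> : x = P (b j) * (1 - c).
    have cE : P (b j `&` a j) = P (b j) * c by rewrite /c ij cprob_mul// setIC.
    have := mreal_setDI mu (mb j) (ma j); rewrite cE -/x; lra.
  rewrite ler_wpM2l//.
  have := mulr_ln_sub_le c0 (@ler01 R) (fun _ => ltr01).
  by rewrite ln1 mulr0 sub0r.
apply: (@le_trans _ _ (Num.sqrt x)).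
  by rewrite -{1}(ger0_norm x0) -sqrtr_sqr ler_sqrt// expr2 ler_piMr.
apply: (le_trans (le_sqrt x x0 xD)).
by rewrite ler_peMl ?sqrtr_ge0// ler1n.
Qed.

Lemma mean_complexity_label_net K : K `<=` partitions (r := r) mu ->
  bounded_mean_complexity mu K -> forall e : R, 0 < e ->
  exists m (y : 'I_m -> 'I_r -> set T), (forall j, K (y j)) /\
    forall x, K x -> exists j, label_dist x (y j) < e.
Proof.
move=> Kp cK e e0.
have [//|[u [Ku uP]]] := finite_net_or_separated K label_dist e.
exfalso.
have fu n : fpart mu (u n) by exact: Kp.
have mu_ n i : measurable (u n i) by have [mun _ _] := fu n; exact: mun.
have du n i j x : u n i x -> u n j x -> i = j.
  move=> ux uy; have [_ dun _] := fu n.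
  apply/eqP; apply: contrapT => /negP/dun; rewrite -subset0 => /(_ x); exact.
have r1 : (0 : R) < r.+1%:R by rewrite ltr0n.
(* Two well approximated partitions will differ by at most [8 * eta] on each of [r] atoms, in total
   [e * r / (2 * r.+1) < e]. *)
pose eta : R := e / (16 * r.+1%:R).
have eta0 : 0 < eta by rewrite divr_gt0// mulr_gt0.
have [C CP] := cK eta eta0.
(* More than N / 2 of the partitions are well approximated on the balls, while
   there are at most (r + 1)^C labellings of the centres; a centre outside all
   atoms is labelled None. *)
pose N := (2 * (r.+1 ^ C).+1)%N.
pose w (i : 'I_N) := u i.
(* [bounded_mean_complexity] concerns distinct partitions; separation makes these distinct. *)
have winj : injective w.
  have dd n : label_dist (u n) (u n) = 0.
    by apply: big1 => i _; rewrite /symdiff setDv setU0 mreal0.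
  move=> i j wij; apply/val_inj; have [ij|ji|//] := ltngtP i j.
  - by have := uP _ _ ij; rewrite -/(w i) wij dd leNgt e0.
  - by have := uP _ _ ji; rewrite -/(w j) -wij dd leNgt e0.
have N0 : (0 < N)%N by [].
have NR : (0 : R) < N%:R by rewrite ltr0n.
have [D [sD muD]] := CP N w N0 winj (fun i => Ku i).
set U := bigcup _ _ in muD.
have mU : measurable U.
  apply: fin_bigcup_measurable; first exact: finite_seq.
  by move=> x _; apply: measurable_hball => k i; exact: mu_.
pose x (j : 'I_(size D)) := tnth (in_tuple D) j.
(* Each point gets one centre, the same for all partitions; a point in no ball is bad for every
   partition. *)
pose near_center y := [pick j | hamming R w (x j) y < eta].
pose Bad i y := if near_center y is Some j then sep_by (w i) (x j) y else True.
pose sg := signature (fun ki : 'I_N * 'I_r => w ki.1 ki.2).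
have sep_sg i z y y' : sg y = sg y' -> sep_by (w i) z y <-> sep_by (w i) z y'.
  move=> yy'; have eyz l := eq_signature yy' (i, l).
  by split=> ns [l [? ?]]; apply: ns; exists l; split => //; exact/eyz.
have mBad i : measurable (Bad i).
  apply: (@measurable_signature_invariant _ _ _ (fun ki : 'I_N * 'I_r => w ki.1 ki.2)).
    by move=> ki; exact: mu_.
  move=> y y' yy'; suff nyy' : near_center y = near_center y'.
    rewrite /Bad nyy'; case: (near_center y') => // j; exact: (sep_sg _ _ _ _ yy').1.
  apply: eq_pick => j; rewrite !hammingE; congr (_ * _%:R < _); apply: eq_card => k.
  by rewrite !finset.inE; apply: asbool_equiv_eq; exact: sep_sg.
have PV : P (~` U) < eta.
  have := mreal_setDI mu (@measurableT _ T) mU; rewrite mrealT setTI setTD.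
  move: muD; rewrite (mrealE mu mU) lte_fin; lra.
have sumBad : \sum_i P (Bad i) <= N%:R * (2 * eta).
  have NeR : 0 <= N%:R * eta by rewrite mulr_ge0// ltW.
  (* In [U] a point is bad for at most [N * eta] partitions, by the Hamming distance to its centre;
     off [U] it is bad for at most all [N]. *)
  apply: (@le_trans _ _ (N%:R * eta + #|'I_N|%:R * P (~` U))).
    apply: sum_mreal_count_le => //; first exact: measurableC.
    move=> y /contrapT[z /= zD zy].
    have [j xjz] : exists j, x j = z.
      by have /tnthP[j ->] : z \in in_tuple D := zD; exists j.
    have [j' ny hy] : exists2 j', near_center y = Some j' & hamming R w (x j') y < eta.
      rewrite /near_center; case: pickP => [j' hj'|/(_ j)]; first by exists j'.
      by rewrite xjz [hamming _ _ _ _ < _]zy.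
    move: hy; rewrite hammingE mulrC ltr_pdivrMr// mulrC => /ltW.
    apply: le_trans; rewrite ler_nat subset_leq_card//.
    by apply/fintype.subsetP => i; rewrite !finset.inE /Bad ny.
  rewrite card_ord -mulrDr ler_pM2l//; lra.
(* The threshold is twice the average bound [2 * eta], so at most half of the partitions are left
   out of [G]. *)
pose G := finset (fun i => P (Bad i) < 4 * eta).
have cardG : ((r.+1 ^ C).+1 <= #|G|)%N.
  have : #|~: G|%:R * (4 * eta) <= N%:R * (2 * eta) :> R.
    apply: le_trans sumBad; rewrite mulr_natl -sumr_const.
    rewrite [leRHS](bigID (mem (~: G)))/= -[leLHS]addr0 lerD//.
      by apply: ler_sum => i; rewrite !finset.inE -leNgt.
    by apply: sumr_ge0 => i _; exact: mreal_ge0.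
  have -> : N%:R * (2 * eta) = (r.+1 ^ C).+1%:R * (4 * eta) by rewrite /N natrM; ring.
  rewrite ler_pM2r ?mulr_gt0// ler_nat => cG.
  have NE : N = ((r.+1 ^ C).+1 + (r.+1 ^ C).+1)%N by rewrite /N mul2n addnn.
  have := cardsC G; rewrite card_ord [RHS]NE => cE.
  by rewrite -(leq_add2r #|~: G|) cE leq_add2l.
pose label i : {ffun 'I_(size D) -> option 'I_r} :=
  [ffun j => [pick l | `[< w i l (x j) >]]].
have [i [i' [iG i'G ii' lab]]] :
    exists i i', [/\ i \in G, i' \in G, i != i' & label i = label i'].
  apply: contrapT => nex.
  have linj : {in G &, injective label}.
    move=> i i' iG i'G lab; apply/eqP; apply: contrapT => /negP ii'.
    by apply: nex; exists i, i'.
  have := max_card [set label i | i in G]%SET.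
  rewrite card_in_imset// card_ffun card_option !card_ord => cG.
  have := leq_trans cardG cG; rewrite ltnNge leq_pexp2l//.
(* Off [Bad k], a point lies in the same atom as its centre, so the label of the centre determines
   the atom. *)
have labP k y l : ~ Bad k y -> w k l y ->
    exists2 j, near_center y = Some j & label k j = Some l.
  rewrite /Bad; case: (near_center y) => // j /contrapT[l' [wx wy]] wl.
  exists j => //; rewrite ffunE; case: pickP => [l'' /asboolP wl''|/(_ l')/asboolP//].
  by congr Some; rewrite (du _ _ _ _ wl'' wx) (du _ _ _ _ wl wy).
have small : label_dist (w i) (w i') < e.
  have mBB : measurable (Bad i `|` Bad i') by exact: measurableU.
  apply: (@le_lt_trans _ _ (\sum_(l < r) 8 * eta)).
    apply: ler_sum => l _; apply: (@le_trans _ _ (P (Bad i `|` Bad i'))).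
      apply: le_mreal => //; first exact: (measurable_symdiff (mu_ i l) (mu_ i' l)).
      move=> y yl; apply: contrapT => /not_orP[nB nB'].
      have inw k : ~ Bad k y -> exists l', w k l' y.
        rewrite /Bad; case: (near_center y) => // j /contrapT[l' [_ wy]]; by exists l'.
      have [l1 w1] := inw i nB; have [l2 w2] := inw i' nB'.
      have [j nj lj] := labP _ _ _ nB w1; have [j' + lj'] := labP _ _ _ nB' w2.
      rewrite nj => -[jj']; move: lj'; rewrite -jj' -lab lj => -[l12].
      case: yl => -[wl nwl]; apply: nwl.
      - by rewrite (du _ _ _ _ wl w1) l12.
      - by rewrite (du _ _ _ _ wl w2) -l12.
    apply: le_trans (mreal_setU mu (mBad i) (mBad i')) _.
    by move: iG i'G; rewrite !finset.inE; lra.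
  rewrite sumr_const card_ord -[ltLHS]mulr_natl /eta.
  have rr : (r%:R : R) < r.+1%:R by rewrite ltr_nat.
  have -> : r%:R * (8 * (e / (16 * r.+1%:R))) = e * (r%:R / r.+1%:R / 2).
    by field; rewrite gt_eqF.
  rewrite gtr_pMr// ltr_pdivrMr// ltr_pdivrMr//; lra.
have [ij|ji|ij] := ltngtP i i'.
- by have := uP _ _ ij; rewrite label_distC leNgt small.
- by have := uP _ _ ji; rewrite leNgt small.
- by move: ii'; rewrite -val_eqE/= ij eqxx.
Qed.

(** Finite nets in [label_dist] give a subsequence with geometrically small distances, and its limit
    is taken slot by slot as [set_liminf]. *)
Lemma mean_complexity_rokhlin_precompact K : K `<=` partitions (r := r) mu ->
  bounded_mean_complexity mu K -> rokhlin_precompact mu K.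
Proof.
move=> Kp cK u Ku.
have fu n : fpart mu (u n) by exact: Kp.
have mu_ n i : measurable (u n i) by have [mun _ _] := fu n; exact: mun.
have [|phi [phiS phiP]] := @totally_bounded_subseq R (fun n n' => label_dist (u n) (u n')).
  move=> e e0; have e2 : 0 < e / 2 by rewrite divr_gt0.
  have [m [y [Ky yP]]] := mean_complexity_label_net Kp cK e2.
  have /choice[c cP] n : exists j, label_dist (u n) (y j) < e / 2 by exact: yP.
  exists 'I_m, c => n n' cn.
  have my j i : measurable (y j i) by have [myj _ _] := Kp _ (Ky j); exact: myj.
  apply: le_lt_trans (label_dist_triangle (mu_ n) (my (c n)) (mu_ n')) _.
  by rewrite (splitr e) ltrD// cn label_distC.
pose b i := set_liminf (fun n => u (phi n) i).
have mb i : measurable (b i) by apply: measurable_set_liminf => n; exact: mu_.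
have dist_b n : label_dist (u (phi n)) b <= 2 * r%:R * 2^-1 ^+ n.
  apply: (@le_trans _ _ (\sum_(i < r) 2 * 2^-1 ^+ n)).
    apply: ler_sum => i _.
    apply: (@mreal_symdiff_liminf _ _ _ mu (fun n => u (phi n) i)) => // k.
    by apply: le_trans (label_dist_ge _ _ i) _; exact/ltW/phiP.
  by rewrite sumr_const card_ord -[leLHS]mulr_natl mulrCA mulrA.
have mUb : measurable (\bigcup_i b i) by exact: measurable_bigcup_fin.
have fb : fpart mu b.
  split=> //.
    move=> i j ij; rewrite -subset0 => x [[N _ Ni] [M _ Mj]].
    have [_ /(_ _ _ ij) + _] := fu (phi (N + M)%N); rewrite -subset0 => /(_ x); apply.
    by split; [exact: Ni|rewrite addnC; exact: Mj].
  apply: measure_eq0; first exact: measurableC.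
  (* The part not covered by [b] has a fixed measure, bounded by quantities that tend to 0. *)
  suff -> : P (~` \bigcup_i b i) = 0 by [].
  suff : (fun=> P (~` \bigcup_i b i)) @ \oo --> (0 : R).
    by move/cvg_lim => <- //; apply/esym/cvg_lim => //; exact: cvg_cst.
  apply: (@cvg0_le_geometric _ _ (2 * r%:R)) => n; rewrite mreal_ge0/=.
  apply: le_trans (dist_b n).
  have mS i : measurable (symdiff (u (phi n) i) (b i)) by exact: measurable_symdiff.
  have mUu : measurable (\bigcup_i u (phi n) i) by exact: measurable_bigcup_fin.
  have mUS : measurable (\bigcup_i symdiff (u (phi n) i) (b i)) by exact: measurable_bigcup_fin.
  apply: (@le_trans _ _ (P (~` \bigcup_i u (phi n) i) +
      P (\bigcup_i symdiff (u (phi n) i) (b i)))).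
    apply: le_trans (mreal_setU mu (measurableC mUu) mUS).
    apply: le_mreal; [exact: measurableC|by apply: measurableU => //; exact: measurableC|].
    move=> x nb; apply: contrapT => /not_orP[/contrapT[i _ ui] nS]; apply: nS.
    by exists i => //; left; split => // bi; apply: nb; exists i.
  rewrite [X in X + _](_ : _ = 0) ?add0r; last by rewrite /mreal; have [_ _ ->] := fu (phi n).
  exact: mreal_cover_le.
exists phi; split=> //; exists b => //.
have cvgD : (fun n => label_dist (u (phi n)) b) @ \oo --> (0 : R).
  apply: (@cvg0_le_geometric _ _ (2 * r%:R)) => n; rewrite dist_b andbT.
  by apply: sumr_ge0 => i _; exact: mreal_ge0.
have cvgS : (fun n => 4 * r%:R ^+ 2 * Num.sqrt (label_dist (u (phi n)) b)) @ \oo --> (0 : R).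
  suff : (fun n => 4 * r%:R ^+ 2 * Num.sqrt (label_dist (u (phi n)) b)) @ \oo -->
      4 * r%:R ^+ 2 * Num.sqrt (0 : R) by rewrite sqrtr0 mulr0.
  apply: cvgM; first exact: cvg_cst.
  by apply: (cvg_comp _ _ cvgD); exact: sqrt_continuous.
apply: (squeeze_cvgr _ (cvg_cst 0) cvgS); apply: nearW => n.
rewrite rokhlin_ge0//= /rokhlin !cond_entropyE//.
apply: le_trans (lerD (part_cond_entropy_label_dist (fu _) fb)
  (part_cond_entropy_label_dist fb (fu _))) _.
by rewrite (label_distC b) -mulrDl -mulrDl -natrD.
Qed.

End Labelled.

Theorem theorem1p1 (d : measure_display) (T : measurableType d) (R : realType)
  (mu : probability T R) (r : nat) (K : set ('I_r -> set T)) :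
  standard_borel T R ->
  (2 <= r)%N ->
  K `<=` partitions (r := r) mu ->
  (forall a b, K a -> K b -> same_partition mu a b -> a = b) ->
  [<-> rokhlin_precompact mu K;
       max_pattern_entropy mu K = 0%E;
       L2_precompact mu (atom_indicators (R := R) K);
       bounded_mean_complexity mu K].
Proof.
move=> _ _ Kp _; tfae.
- by move=> preK; exact/max_pattern_entropy_eq0/rokhlin_precompact_join_entropy.
- exact: max_pattern_entropy_L2_precompact.
- exact: L2_precompact_mean_complexity.
- exact: mean_complexity_rokhlin_precompact.
Qed.
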